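(* Let $K$ be a knot (in $S^3$) and let $\mathbb{F}$ be a field of characteristic different from $2$. Then \[ \mathrm{xo}_{\mathbb{F}}(K) = \widetilde{\mathrm{pg}}_{\mathbb{F}}(K) - 1, \] where $\mathrm{xo}_{\mathbb{F}}(K)$ is the $X$-torsion order of $K$ over $\mathbb{F}$, and $\widetilde{\mathrm{pg}}_{\mathbb{F}}(K)$ is the number of pages in the reduced Bar-Natan--Lee--Turner spectral sequence of $K$ with coefficients in $\mathbb{F}$.
   Context: **Frobenius systems and link complexes.** A (commutative) Frobenius system is a tuple $\mathcal{F}=(R,A,\varepsilon,\Delta)$ with $A$ a commutative ring, $R\subseteq A$ a subring, $\varepsilon\colon A\to R$ an $R$-module map, and $\Delta\colon A\to A\otimes_R A$ an $A$-bimodule map that is co-associative and co-commutative, with $(\varepsilon\otimes\mathrm{id})\circ\Delta=\mathrm{id}$. If $A$ is free of rank $2$ over $R$, then a link diagram $D$ gives Khovanov's cochain complex $C(D;\mathcal{F})$ of $R$-modules. It is formed from the cube of resolutions of $D$: a vertex whose resolution has $m$ circles receives $A^{\otimes_R m}$ (one tensor factor per circle). Edges at which two circles merge receive the multiplication $A\otimes_R A\to A$, edges at which one circle splits receive $\Delta$ (both extended by the identity on the other factors), with the usual signs making all squares anticommute. If $D$ has $n_+$ positive and $n_-$ negative crossings, a vertex $v$ with $|v|$ one-resolutions is placed in homological degree $|v|-n_-$. When $R$ and $A$ are graded as below, the summand $A^{\otimes m}$ at $v$ is shifted up by $m+|v|+n_+-2n_-$. The resulting grading is called the $q$-grading, and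 the differential preserves it. The homology of $C(D;\mathcal{F})$ is a link invariant. After choosing a base point on $D$ (away from crossings), $C(D;\mathcal{F})$ becomes a complex of $A$-modules, with $A$ acting by multiplication on the tensor factor of the circle containing the base point. **Lee complex and $X$-torsion order.** Take ground ring $\mathbb{F}[T]$ and $A=\mathbb{F}[X,T]/(X^2-T)$, with $\deg 1=0$, $\deg T=-4$, $\deg X=-2$, $\varepsilon(1)=0$, $\varepsilon(X)=1$, $\Delta(1)=1\otimes X+X\otimes 1$, $\Delta(X)=X\otimes X+T\otimes 1$. The resulting complex is $C_{\mathrm{Lee}}(D;\mathbb{F}[T])$, with homology $H_{\mathrm{Lee}}(D;\mathbb{F}[T])$. Since $T=X^2$ in $A$, we have $A\cong\mathbb{F}[X]$, and a base point makes $C_{\mathrm{Lee}}(D;\mathbb{F}[T])$ a complex, and $H_{\mathrm{Lee}}$ a module, over $\mathbb{F}[X]$. For a diagram $D$ of a knot $K$ let \[ T(K)=\{a\in H_{\mathrm{Lee}}(D;\mathbb{F}[T]) \mid X^n a=0 \text{ for some } n\geq 0\}. \] The $X$-torsion order $\mathrm{xo}_{\mathbb{F}}(K)$ is the minimal integer $n\ge 0$ such that $X^n\,T(K)=0$. For a knot it does not depend on the diagram or base point. **Reduced Bar-Natan complex and its spectral sequence.** Take ground ring $\mathbb{F}[H]$ and $B=\mathbb{F}[X,H]/(X^2-XH)$, with $\deg 1=0$, $\deg H=\deg X=-2$, $\varepsilon(1)=0$, $\varepsilon(X)=1$, $\Delta(1)=1\otimes X+X\otimes 1-H\otimes 1$,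 $\Delta(X)=X\otimes X$. The resulting complex is $C_{\mathrm{BN}}(D;\mathbb{F}[H])$. After choosing a base point, the reduced complex is the subcomplex \[ \widetilde{C}_{\mathrm{BN}}(D;\mathbb{F}[H])=X\cdot C_{\mathrm{BN}}(D;\mathbb{F}[H]), \] a bigraded complex of finitely generated free $\mathbb{F}[H]$-modules. Setting $H=1$, i.e. tensoring with $\mathbb{F}$ over $\mathbb{F}[H]$ via $H\mapsto 1$, gives a finite-dimensional cochain complex over $\mathbb{F}$. It has a descending filtration in which $F^{j}$ is spanned by the images of homogeneous $\mathbb{F}[H]$-basis elements of $q$-degree at least $j$. All these $q$-degrees have the same parity, and the filtration is indexed in steps of $2$ in the $q$-degree, so that the differential $d_r$ of the $r$-th page raises the $q$-degree by $2r$. The associated graded complex is the reduced Khovanov complex (obtained by setting $H=0$), so the $E_1$-page is the reduced Khovanov homology of $K$ with coefficients in $\mathbb{F}$. This is the reduced Bar-Natan--Lee--Turner spectral sequence of $K$ over $\mathbb{F}$. Its number of pages $\widetilde{\mathrm{pg}}_{\mathbb{F}}(K)$ is the least $k\ge 1$ such that $E_k=E_\infty$ (the $E_1$-page being the reduced Khovanov homology). *)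

(* Defs.v *)
From HB Require Import structures.
From mathcomp Require Import all_boot all_order all_algebra ring.

Set Implicit Arguments.
Unset Strict Implicit.
Unset Printing Implicit Defensive.

Import GRing.Theory.
Local Open Scope ring_scope.

(** * Oriented knot diagrams, as planar diagram codes *)

(* [arc k 0, arc k 1, arc k 2, arc k 3] are the arcs met counterclockwise around
   the crossing [k], starting from the incoming end of the lower strand; so the
   lower strand runs from slot 0 to slot 2. The upper strand runs from slot 3 to
   slot 1 at a positive crossing and from slot 1 to slot 3 at a negative one.
   An arc that meets no crossing is a circle. *)
Record diagram := Diagram {
  ncross : nat;
  narcs : nat;
  arc : 'I_ncross -> 'I_4 -> 'I_narcs;
  positive : pred 'I_ncross
}.

Section Diagrams.
Variable D : diagram.
Implicit Types (k : 'I_(ncross D)) (s : 'I_4) (a b : 'I_(narcs D)).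

Definition outgoing k s : bool :=
  (s == 2) || (s == if positive k then 1 else 3).

Definition out_ends a :=
  [set e : 'I_(ncross D) * 'I_4 | (arc e.1 e.2 == a) && outgoing e.1 e.2].
Definition in_ends a :=
  [set e : 'I_(ncross D) * 'I_4 | (arc e.1 e.2 == a) && ~~ outgoing e.1 e.2].

Definition well_oriented : bool :=
  [forall a, (#|out_ends a| == #|in_ends a|) && (#|out_ends a| <= 1)%N].

Definition strand : rel 'I_(narcs D) := fun a b =>
  [exists k, exists s, (arc k s == a) && (arc k (s + 2) == b)].
Definition ncomponents : nat := n_comp strand predT.

(* The two sides of an arc [a] are [(a, true)] (left of its orientation) and
   [(a, false)] (right). The corner of the crossing [k] between the slots [s] and
   [s + 1] touches the counterclockwise side of the former, seen from [k], and
   the clockwise side of the latter. *)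
Definition corner k s : ('I_(narcs D) * bool) * ('I_(narcs D) * bool) :=
  ((arc k s, outgoing k s), (arc k (s + 1), ~~ outgoing k (s + 1))).
Definition adjacent_sides : rel ('I_(narcs D) * bool) := fun u w =>
  [exists k, exists s, (corner k s == (u, w)) || (corner k s == (w, u))].
Definition nregions : nat := n_comp adjacent_sides predT.

(* Planarity is Euler's formula: the underlying 4-valent graph of a knot diagram
   is connected, with [ncross] vertices and [2 * ncross] edges. It holds with the
   same number of regions for the crossingless circle. *)
Definition knot_diagram : bool :=
  [&& well_oriented, ncomponents == 1 & nregions == (ncross D).+2]%N.

Definition npos : nat := #|[pred k : 'I_(ncross D) | positive k]|.
Definition nneg : nat := #|[pred k : 'I_(ncross D) | ~~ positive k]|.

(** ** Resolutions *)

Definition vertex := {ffun 'I_(ncross D) -> bool}.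

(* The 0-resolution joins the slots 0,1 and 2,3 (it is the oriented one at a
   positive crossing); the 1-resolution joins 1,2 and 3,0. *)
Definition partner (r : bool) s : 'I_4 := if odd s == r then s + 1 else s - 1.
Definition joined (v : vertex) : rel 'I_(narcs D) := fun a b =>
  [exists k, exists s, (arc k s == a) && (arc k (partner (v k) s) == b)].
Definition same_circle (v : vertex) : rel 'I_(narcs D) := connect (joined v).

(* Enhanced resolutions: a vertex [v] and a labelling of the circles of the
   resolution [v] by the basis of A, where [false] stands for 1 and [true] for X.
   Those over [v] index the monomial basis of the tensor power of A at [v]. *)
Definition state := {s : vertex * {ffun 'I_(narcs D) -> bool} |
  [forall a, forall b, same_circle s.1 a b ==> (s.2 a == s.2 b)]}.

Definition res (x : state) : vertex := (val x).1.
Definition lab (x : state) (a : 'I_(narcs D)) : bool := (val x).2 a.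

Lemma lab_circle (x : state) a b : same_circle (res x) a b -> lab x a = lab x b.
Proof.
by move=> ab; move/forallP/(_ a)/forallP/(_ b)/implyP: (valP x) => /(_ ab) /eqP.
Qed.

Lemma joined_sym v : symmetric (joined v).
Proof.
have H a b : joined v a b -> joined v b a.
  move=> /existsP[k /existsP[s /andP[/eqP<- /eqP<-]]].
  apply/existsP; exists k; apply/existsP; exists (partner (v k) s).
  rewrite eqxx; suff -> : partner (v k) (partner (v k) s) = s by rewrite eqxx.
  by apply/val_inj; case: (v k); case: s => -[|[|[|[|]]]].
by move=> a b; apply/idP/idP; apply: H.
Qed.

Lemma same_circle_sym v : symmetric (same_circle v).
Proof. exact/sym_connect_sym/joined_sym. Qed.

Lemma same_circleW v a b c :
  same_circle v a b -> same_circle v a c = same_circle v b c.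
Proof. move=> ab; exact: (same_connect (same_circle_sym v) ab c). Qed.

Definition weight (v : vertex) : nat := #|[pred k | v k]|.
Definition ncircles (v : vertex) : nat := n_comp (joined v) predT.
Definition nXcircles (x : state) : nat := n_comp (joined (res x)) (lab x).

Definition hdeg (x : state) : int := (weight (res x))%:Z - nneg%:Z.
Definition qdeg (x : state) : int :=
  - 2 * (nXcircles x)%:Z
  + ((ncircles (res x))%:Z + (weight (res x))%:Z + npos%:Z - 2 * nneg%:Z).

End Diagrams.

(** * Frobenius systems of rank two *)

(* A is free over R on 1 and X, written [false] and [true]: [fmul a b c] is the
   coefficient of c in a b, [fcomul a b c] that of b (x) c in Delta(a). *)
Record frobenius (R : comNzRingType) := Frobenius {
  fmul : bool -> bool -> bool -> R;
  fcounit : bool -> R;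
  fcomul : bool -> bool -> bool -> R;
  fmul1 : forall a b, fmul false a b = (a == b)%:R;
  fmulC : forall a b c, fmul a b c = fmul b a c;
  fmulA : forall a b c d,
    \sum_e fmul a b e * fmul e c d = \sum_e fmul b c e * fmul a e d;
  fcomul_linear : forall a b c d,
    \sum_e fmul a b e * fcomul e c d = \sum_e fcomul b e d * fmul a e c;
  fcomulA : forall a b c d,
    \sum_e fcomul a e d * fcomul e b c = \sum_e fcomul a b e * fcomul e c d;
  fcomulC : forall a b c, fcomul a b c = fcomul a c b;
  fcounitP : forall a b, \sum_e fcounit e * fcomul a e b = (a == b)%:R
}.

(* A = R[X] / (X^2 - h X - t), with Delta(1) = 1 (x) X + X (x) 1 - h 1 (x) 1 and
   Delta(X) = X (x) X + t 1 (x) 1. *)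
Section Quadratic.
Variables (R : comNzRingType) (h t : R).

Definition qmul (a b c : bool) : R :=
  if a && b then (if c then h else t) else ((a || b) == c)%:R.
Definition qcounit (a : bool) : R := a%:R.
Definition qcomul (a b c : bool) : R :=
  match a, b, c with
  | false, false, false => - h
  | false, true, false | false, false, true => 1
  | true, true, true => 1
  | true, false, false => t
  | _, _, _ => 0
  end.

Fact qmul1 a b : qmul false a b = (a == b)%:R.
Proof. by case: a; case: b. Qed.
Fact qmulC a b c : qmul a b c = qmul b a c.
Proof. by case: a; case: b. Qed.
Fact qmulA a b c d :
  \sum_e qmul a b e * qmul e c d = \sum_e qmul b c e * qmul a e d.
Proof. by case: a; case: b; case: c; case: d; rewrite ?big_bool /qmul ?/qcomul ?/qcounit /=; ring. Qed.
Fact qcomul_linear a b c d :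
  \sum_e qmul a b e * qcomul e c d = \sum_e qcomul b e d * qmul a e c.
Proof. by case: a; case: b; case: c; case: d; rewrite ?big_bool /qmul ?/qcomul ?/qcounit /=; ring. Qed.
Fact qcomulA a b c d :
  \sum_e qcomul a e d * qcomul e b c = \sum_e qcomul a b e * qcomul e c d.
Proof. by case: a; case: b; case: c; case: d; rewrite ?big_bool /qmul ?/qcomul ?/qcounit /=; ring. Qed.
Fact qcomulC a b c : qcomul a b c = qcomul a c b.
Proof. by case: a; case: b; case: c. Qed.
Fact qcounitP a b : \sum_e qcounit e * qcomul a e b = (a == b)%:R.
Proof. by case: a; case: b; rewrite ?big_bool /qcomul ?/qcounit /=; ring. Qed.

Definition quadratic_frobenius : frobenius R :=
  Frobenius qmul1 qmulC qmulA qcomul_linear qcomulA qcomulC qcounitP.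
End Quadratic.

(** * The cube of resolutions complex *)

Section Complex.
Variables (R : comNzRingType) (A : frobenius R) (D : diagram).
Implicit Types (x y : state D) (k : 'I_(ncross D)).

Definition chain := {ffun state D -> R}.

Definition is_edge k (v w : vertex D) : bool :=
  ~~ v k && (w == [ffun j => v j || (j == k)]).
Definition edge_sign k (v : vertex D) : R :=
  (-1) ^+ #|[pred j : 'I_(ncross D) | (j < k)%N && v j]|.

(* The coefficient of [y] in the image of [x] under the edge map at [k]. The
   circles of [res x] through [k] are those of the arcs in the slots 0 and 2, and
   likewise for [res y]; the other circles keep their labels. *)
Definition edge_coef k x y : R :=
  let a0 := arc k 0 in let a2 := arc k 2 in
  if [forall a, [|| same_circle (res x) a a0, same_circle (res x) a a2
                  | lab x a == lab y a]]
  then match same_circle (res x) a0 a2, same_circle (res y) a0 a2 with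
       | true, false => fcomul A (lab x a0) (lab y a0) (lab y a2)
       | false, true => fmul A (lab x a0) (lab x a2) (lab y a0)
       | _, _ => 0 (* does not happen in a planar diagram *)
       end
  else 0.

Definition dcoef x y : R :=
  \sum_(k | is_edge k (res x) (res y)) edge_sign k (res x) * edge_coef k x y.

Definition differential (c : chain) : chain :=
  [ffun y => \sum_x c x * dcoef x y].

(* The action of X at the base point [p]. *)
Definition Xcoef (p : 'I_(narcs D)) x y : R :=
  if (res x == res y) &&
     [forall a, same_circle (res x) a p || (lab x a == lab y a)]
  then fmul A true (lab x p) (lab y p) else 0.
Definition Xact (p : 'I_(narcs D)) (c : chain) : chain :=
  [ffun y => \sum_x c x * Xcoef p x y].

End Complex.

Arguments differential {R} A {D} c.
Arguments Xact {R} A {D} p c.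

Definition is_least (P : nat -> Prop) (n : nat) : Prop :=
  P n /\ forall m, P m -> (n <= m)%N.

(** * The X-torsion order *)

Section Lee.
Variables (F : fieldType) (D : diagram) (p : 'I_(narcs D)).

(* The ground ring is [{poly F}], with T = ['X]. *)
Definition Lee : frobenius {poly F} := quadratic_frobenius 0 'X.

Definition Lee_chain := chain {poly F} D.
Definition Lee_cycle (z : Lee_chain) : Prop := differential Lee z = 0.
Definition Lee_boundary (z : Lee_chain) : Prop :=
  exists c : Lee_chain, z = differential Lee c.

(* [X^n] annihilates the homology class of the cycle [z]. *)
Definition Xpow_kills (n : nat) (z : Lee_chain) : Prop :=
  Lee_boundary (iter n (Xact Lee p) z).

Definition Xpow_kills_torsion (n : nat) : Prop :=
  forall z, Lee_cycle z -> (exists m, Xpow_kills m z) -> Xpow_kills n z.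

Definition is_X_torsion_order : nat -> Prop := is_least Xpow_kills_torsion.
End Lee.

(** * Spectral sequence of a filtered complex *)

(* [Fil i j] is the j-th step of a descending filtration, bounded and jumping only
   at indices j of one parity, on the summand of degree [i] of the complex; [d]
   raises [i] by 1. For [1 <= r],
     E_r^{i,j} = page_num r i j / page_den r i j
   and E_oo^{i,j} = page_num_inf i j / page_den_inf i j, as subquotients of
   Fil i j / Fil i (j + 2); here the two members contain Fil i (j + 2), and the
   differential of E_r, induced by d, raises j by 2 r. *)
Section SpectralSequence.
Variables (F : fieldType) (V : vectType F) (d : 'End(V)).
Variable Fil : int -> int -> {vspace V}.
Local Open Scope vspace_scope.

Definition almost_cycles (r : nat) (i j : int) : {vspace V} :=
  Fil i j :&: (d @^-1: Fil (i + 1)%R (j + 2 * r%:Z)%R).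
Definition page_num (r : nat) (i j : int) : {vspace V} :=
  almost_cycles r i j + Fil i (j + 2)%R.
Definition page_den (r : nat) (i j : int) : {vspace V} :=
  d @: almost_cycles r.-1 (i - 1)%R (j - 2 * (r.-1)%:Z)%R + Fil i (j + 2)%R.

Definition page_num_inf (i j : int) : {vspace V} :=
  Fil i j :&: lker d + Fil i (j + 2)%R.
Definition page_den_inf (i j : int) : {vspace V} :=
  Fil i j :&: limg d + Fil i (j + 2)%R.

Definition page_eq_infinity (r : nat) : Prop := forall i j,
  page_num r i j = page_num_inf i j /\ page_den r i j = page_den_inf i j.

Definition is_number_of_pages : nat -> Prop :=
  is_least (fun k => (1 <= k)%N /\ page_eq_infinity k).
End SpectralSequence.

(** * The reduced Bar-Natan complex *)

Section BarNatan.
Variables (F : fieldType) (D : diagram) (p : 'I_(narcs D)).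

(* The ground ring is [{poly F}], with H = ['X]. *)
Definition BarNatan : frobenius {poly F} := quadratic_frobenius 'X 0.

(* The reduced complex X C is free on the states in which the circle through [p]
   is labelled X: see [reducedP] and [reduced_stable]. *)
Definition rstate := {x : state D | lab x p}.

Let relabel_subproof (e : bool) (x : state D) :
  [forall a, forall b, same_circle (res x) a b ==>
    ([ffun a => if same_circle (res x) a p then e else lab x a] a ==
     [ffun a => if same_circle (res x) a p then e else lab x a] b)].
Proof.
apply/forallP => a; apply/forallP => b; apply/implyP => ab; rewrite !ffunE.
by rewrite (same_circleW _ ab) (lab_circle ab).
Qed.
Let relabel e x : state D := exist _ (_, _) (relabel_subproof e x).

Lemma reducedP (c : chain {poly F} D) :
  (exists b, c = Xact BarNatan p b) <-> (forall x, ~~ lab x p -> c x = 0).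
Proof.
have Xp0 b y : ~~ lab y p -> Xact BarNatan p b y = 0.
  move=> yp; rewrite ffunE big1 // => x _; rewrite /Xcoef (negPf yp).
  by case: ifP => _; rewrite ?mulr0 //= /qmul /=; case: (lab x p); rewrite mulr0.
split=> [[b ->] x /Xp0 //| c0].
exists [ffun x => if lab x p then 0 else c (relabel true x)].
apply/ffunP => y; case: (boolP (lab y p)) => yp; last by rewrite Xp0 // c0.
have pp x : same_circle (res x) p p by apply: connect0.
have Elab e x a : lab (relabel e x) a =
    if same_circle (res x) a p then e else lab x a by rewrite /lab ffunE.
have Ey x : res x = res y ->
    (forall a, same_circle (res y) a p \/ lab x a = lab y a) -> relabel true x = y.
  move=> rxy H; apply/val_inj; rewrite [RHS]surjective_pairing.
  congr pair => //; apply/ffunP => a; rewrite ffunE rxy.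
  by case: ifP => [/lab_circle /esym | ap]; [rewrite yp | case: (H a) => //; rewrite ap].
rewrite ffunE (bigD1 (relabel false y)) //= big1 ?addr0 => [|x /eqP xy].
  rewrite ffunE Elab pp Ey // => [|a]; last first.
    by rewrite Elab; case: ifP; [left | right].
  rewrite /Xcoef eqxx Elab pp yp /=; case: ifP => [_|/negP[]]; first by rewrite /qmul /= mulr1.
  by apply/forallP => a; rewrite Elab; case: ifP => //= ->; rewrite ?orbT ?eqxx.
rewrite ffunE; case: ifP => xp; first by rewrite mul0r.
rewrite /Xcoef; case: ifP => [/andP[/eqP rxy /forallP H]|]; last by rewrite mulr0.
case: xy; apply/val_inj; rewrite [LHS]surjective_pairing; congr pair => //.
apply/ffunP => a; rewrite ffunE -rxy; case: ifP => [/lab_circle|ap].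
  by rewrite -/(lab x a) => ->.
by move: (H a); rewrite ap /= => /eqP.
Qed.

Lemma reduced_stable (x y : state D) :
  lab x p -> ~~ lab y p -> dcoef BarNatan x y = 0.
Proof.
move=> xp yp; rewrite /dcoef big1 // => k /andP[vk /eqP wE].
suff -> : edge_coef BarNatan k x y = 0 by rewrite mulr0.
rewrite /edge_coef; set a0 := arc k 0; set a2 := arc k 2.
case: ifP => // /forallP/(_ p); rewrite xp (negPf yp) orbF => pv.
pose S := [pred a | same_circle (res y) a a0 || same_circle (res y) a a2].
have wk : res y k by rewrite wE ffunE eqxx orbT.
have slots s : arc k s \in S.
  have J s' : same_circle (res y) (arc k s') (arc k (partner true s')).
    apply: connect1; apply/existsP; exists k; apply/existsP; exists s'.
    by rewrite eqxx wk eqxx.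
  rewrite inE; have := J s; have : [|| s == 0, s == 1, s == 2 | s == 3].
    by case: s => -[|[|[|[|]]]].
  case/or4P=> /eqP-> H; rewrite ?[same_circle _ a0 a0]connect0
    ?[same_circle _ a2 a2]connect0 ?orbT //.
    by rewrite (_ : partner true 1 = 2) in H; [rewrite H orbT | apply/val_inj].
  by rewrite (_ : partner true 3 = 0) in H; [rewrite H | apply/val_inj].
have Sclosed : closed (joined (res x)) S.
  apply: intro_closed => [|a b]; first exact/sym_connect_sym/joined_sym.
  move=> /existsP[j /existsP[s /andP[/eqP<- /eqP<-]]].
  have [->|jk] := eqVneq j k; first by rewrite slots.
  rewrite !inE; set u := arc j s; set w := arc j _.
  have uw : same_circle (res y) u w.
    apply: connect1; apply/existsP; exists j; apply/existsP; exists s.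
    by rewrite eqxx wE ffunE (negPf jk) orbF eqxx.
  by rewrite !(same_circleW _ uw).
have pS : p \in S.
  by case/orP: (pv) => /(closed_connect Sclosed) ->; apply: slots.
have {pS} ye : ~~ (lab y a0 && lab y a2).
  by case/orP: pS => /lab_circle <-; rewrite (negPf yp) ?andbF.
have {pv} xe : lab x a0 || lab x a2.
  by case/orP: pv => /lab_circle <-; rewrite xp ?orbT.
case: ifP => xa; case: ifP => ya //=.
  move: xe ye; rewrite (lab_circle xa) orbb => ->.
  by case: (lab y a0); case: (lab y a2).
move: xe ye; rewrite -(lab_circle ya) andbb => xe /negPf->.
by rewrite /qmul; case: (lab x a0) xe => //=; case: (lab x a2).
Qed.

(* The reduced complex at H = 1, on the images of that basis. *)
Definition BLT_chain := {ffun rstate -> F^o}.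
Definition BLT_differential (c : BLT_chain) : BLT_chain :=
  [ffun y : rstate => \sum_(x : rstate) c x * (dcoef BarNatan (val x) (val y)).[1]].

Fact BLT_differential_linear : linear BLT_differential.
Proof.
move=> a b c; apply/ffunP => y; rewrite !ffunE scaler_sumr -big_split.
by apply: eq_bigr => x _; rewrite !ffunE mulrDl -scalerAl.
Qed.
HB.instance Definition _ := GRing.isLinear.Build F BLT_chain BLT_chain *:%R
  BLT_differential BLT_differential_linear.

Definition BLT_basis (x : rstate) : BLT_chain := [ffun y => (y == x)%:R].

Definition BLT_filtration (i j : int) : {vspace BLT_chain} :=
  span [seq BLT_basis x | x : rstate <- enum {: rstate}
                        & (hdeg (val x) == i) && (j <= qdeg (val x))].

Definition is_reduced_pages : nat -> Prop :=
  is_number_of_pages (linfun BLT_differential) BLT_filtration.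
End BarNatan.

(* Main.v *)
From Stdlib Require Import Classical_Prop.
From mathcomp Require Import all_boot all_order all_algebra all_fingroup ring zify.
Require Import Defs.

(** Put H = 2X. Multiplying by X + H / 2 at the base point identifies the Lee complex, as a
complex of F[X]-modules, with the reduced Bar-Natan complex: if x is the action of the base
point and Y the variable of another circle, then Y^2 = x^2 says that Z = Y + x satisfies
Z^2 = 2 x Z. Since 2 is invertible, the X-torsion order is the largest order of H-torsion in
the reduced Bar-Natan homology. A summand F[H] / H^n of that homology corresponds to a
nonzero differential d_n of the spectral sequence.

That H-torsion classes can be read off from boundaries at H = 1 uses that the differential
squares to zero, hence that the diagram is planar: Euler's formula yields a checkerboard
colouring, which rules out edges of the cube preserving the number of circles. After
evaluating the circle variables at the roots 0 and H the edge maps become diagonal, and the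
squares of the cube anticommute by counting circles. *)

Set Implicit Arguments.
Unset Strict Implicit.
Unset Printing Implicit Defensive.

Import GRing.Theory.
Local Open Scope ring_scope.

(** * Planarity *)

(** The isomorphism is not built as a map. The Lee complex has coefficients in F[T] and the
    Bar-Natan complex in F[H], and evaluation at the roots is injective but not onto, because H is
    not a unit. So chains on the two sides are compared through their values by the relation
    [related], shown to be total and injective in both directions. Scalars pass from F[T] to F[H] by
    T = H^2 / 4, and odd powers of H are absorbed by the action of X at the base point.

    The bridge from torsion to pages is [boundaries_lift n]: at H = 1, a boundary lying in
    filtration step K bounds a chain in step K - n. Homogenizing chains shows that it holds exactly
    when H^n kills the torsion. The shift by one in the theorem arises because the denominator of
    E_r uses boundaries of chains r - 1 steps lower. *)

Lemma slotP (s : 'I_4) : [\/ s = 0, s = 1, s = 2 | s = 3].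
Proof.
by case: s => -[|[|[|[|//]]]] i; [constructor 1 | constructor 2 | constructor 3
  | constructor 4]; apply: val_inj.
Qed.

Lemma partnerK r : involutive (partner r).
Proof. by move=> s; apply/val_inj; case: r; case: (slotP s) => ->. Qed.

(** A half turn of the slots exchanges the two smoothings; this is what makes a change of smoothing
    a transposition in [edge_toggles_circles]. *)
Lemma partner_addl (s : 'I_4) : [/\ partner true s = partner false (s + 2),
  partner false s = partner true (s + 2) & s + 2 + 2 = s].
Proof. by split; apply/val_inj; case: (slotP s) => ->. Qed.

Lemma fconnect_perm (T : finType) (s : {perm T}) x y :
  fconnect s x y = (y \in porbit s x).
Proof.
apply/idP/porbitP => [/iter_findex <-|[i ->]]; first by exists (findex s x y); rewrite permX.
by rewrite permX fconnect_iter.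
Qed.

(** Here [m] and [n] are the numbers of cycles of a permutation and of its product with a
    transposition; the hypotheses are [porbits_mul_tperm] applied in both directions. *)
Lemma toggle_count (a b : bool) (m n : nat) :
  (n + (~~ a).*2 = m + 1)%N -> (m + (~~ b).*2 = n + 1)%N -> b = ~~ a.
Proof. by case: a; case: b => //= H1 H2; exfalso; lia. Qed.

Section Planarity.
Variable D : diagram.
Hypothesis knotD : knot_diagram D.
(** Planarity is applied to edges of the cube, and an edge supplies a crossing. The arc of the
    crossingless circle has no ends. *)
Variable k0 : 'I_(ncross D).
Implicit Types (k : 'I_(ncross D)) (s : 'I_4) (a b : 'I_(narcs D)).

Lemma strand_sym : symmetric (@strand D).
Proof.
have H a b : strand a b -> strand b a.
  move=> /existsP[k /existsP[s /andP[/eqP<- /eqP<-]]].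
  apply/existsP; exists k; apply/existsP; exists (s + 2).
  by case: (partner_addl s) => _ _ ->; rewrite !eqxx.
by move=> a b; apply/idP/idP; apply: H.
Qed.

Lemma n_comp1_connect (T : finType) (e : rel T) : connect_sym e ->
  n_comp e predT = 1%N -> forall x y, connect e x y.
Proof.
move=> es /eqP; rewrite /n_comp_mem => /card1P[r Hr] x y.
have R z : fingraph.root e z = r.
  have: fingraph.root e z \in predI (roots e) predT by rewrite !inE roots_root.
  by rewrite Hr inE => /eqP.
by rewrite -root_connect // !R.
Qed.

Lemma arcs_connected a b : connect (@strand D) a b.
Proof.
case/and3P: knotD => _ /eqP nc _.
exact: n_comp1_connect (sym_connect_sym strand_sym) nc a b.
Qed.

Lemma arc_end a : exists e : 'I_(ncross D) * 'I_4, arc e.1 e.2 == a.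
Proof.
have /connectP[[|b q]] := arcs_connected (arc k0 0) a.
  by move=> _ ->; exists (k0, 0) => /=.
elim/last_ind: q => [|q c _].
  by rewrite /= andbT => /existsP[k /existsP[s /andP[_ /eqP<-]]] ->; exists (k, s + 2).
rewrite -rcons_cons last_rcons rcons_path => /andP[_].
move=> /existsP[k /existsP[s /andP[_ /eqP<-]]] ->; exists (k, s + 2).
exact: eqxx.
Qed.

Lemma end_unique (e f : 'I_(ncross D) * 'I_4) :
  arc e.1 e.2 = arc f.1 f.2 -> outgoing e.1 e.2 = outgoing f.1 f.2 -> e = f.
Proof.
case/and3P: knotD => /forallP/(_ (arc e.1 e.2)) /andP[/eqP oi o1] _ _ ae oe.
case E: (outgoing e.1 e.2).
  by apply: (card_le1_eqP o1); rewrite !inE -?ae -?oe eqxx E.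
rewrite oi in o1.
by apply: (card_le1_eqP o1); rewrite !inE -?ae -?oe eqxx E.
Qed.

Lemma end_exists a (r : bool) :
  exists e : 'I_(ncross D) * 'I_4, arc e.1 e.2 = a /\ outgoing e.1 e.2 = r.
Proof.
case/and3P: knotD => /forallP/(_ a) /andP[/eqP oi _] _ _.
have [e ea] := arc_end a.
suff: (0 < #|out_ends a|)%N /\ (0 < #|in_ends a|)%N.
  case=> /card_gt0P[f1]; rewrite inE => /andP[/eqP f1a o1].
  case/card_gt0P=> f2; rewrite inE => /andP[/eqP f2a /negPf o2].
  by case: r; [exists f1 | exists f2].
rewrite -oi; case E: (outgoing e.1 e.2).
  suff: (0 < #|out_ends a|)%N by [].
  by apply/card_gt0P; exists e; rewrite inE ea.
suff: (0 < #|in_ends a|)%N by rewrite -oi.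
by apply/card_gt0P; exists e; rewrite inE ea E.
Qed.

(** An arc is determined by the crossing it leaves and by the strand, lower or upper, on which it
    leaves. *)
Lemma narcs_le : (narcs D <= 2 * ncross D)%N.
Proof.
have ex a : exists e : 'I_(ncross D) * 'I_4, (arc e.1 e.2 == a) && outgoing e.1 e.2.
  by have [e [/eqP ea oe]] := end_exists a true; exists e; rewrite ea.
pose f a := let e := xchoose (ex a) in (e.1, e.2 == 2).
have fi : injective f.
  move=> a b; rewrite /f.
  have /andP[/eqP ea oa] := xchooseP (ex a); have /andP[/eqP eb ob] := xchooseP (ex b).
  case=> e1 e2; rewrite -ea -eb; congr arc => //.
  move: oa ob; rewrite /outgoing e2 e1.
  case: eqP e2 => [-> /esym/eqP -> //|_ <- /=].
  by move=> /eqP-> /eqP->.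
by have := leq_card _ fi; rewrite card_prod !card_ord card_bool mulnC.
Qed.

Lemma adjacent_sym : symmetric (@adjacent_sides D).
Proof.
have H u w : adjacent_sides u w -> @adjacent_sides D w u.
  move=> /existsP[k /existsP[s E]].
  by apply/existsP; exists k; apply/existsP; exists s; rewrite orbC.
by move=> a b; apply/idP/idP; apply: H.
Qed.

Let region (u : 'I_(narcs D) * bool) := fingraph.root (@adjacent_sides D) u.
Let Rg := {u : 'I_(narcs D) * bool | roots (@adjacent_sides D) u}.

Let reg u : Rg := Sub (region u) (roots_root (sym_connect_sym adjacent_sym) u).

Let reg_corner k s : reg (arc k s, outgoing k s) = reg (arc k (s + 1), ~~ outgoing k (s + 1)).
Proof.
apply/val_inj/fingraph.rootP; first exact: sym_connect_sym adjacent_sym.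
apply: connect1; apply/existsP; exists k; apply/existsP; exists s.
by rewrite /corner eqxx.
Qed.

Let card_Rg : #|{: Rg}| = (ncross D).+2.
Proof.
case/and3P: knotD => _ _ /eqP <-; rewrite card_sig /nregions /n_comp_mem.
by apply: eq_card => u; rewrite !inE /= andbT.
Qed.

Let M : 'M['F_2]_(#|{: Rg}|, narcs D) :=
  \matrix_(i, a) ((enum_val i == reg (a, true))%:R + (enum_val i == reg (a, false))%:R).
Let N : 'M['F_2]_(narcs D, ncross D) :=
  \matrix_(a, k) \sum_s (arc k s == a)%:R.

Let F2_addrr (x : 'F_2) : x + x = 0.
Proof. by apply/val_inj; case: x => -[|[|//]]. Qed.

Let F2_addr_eq0 (x y : 'F_2) : x + y = 0 -> x = y.
Proof. by move=> xy; rewrite -[x]addr0 -(F2_addrr y) addrA xy add0r. Qed.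

(** The eight sides of arcs seen at a crossing pair off into its four corners, and both sides at a
    corner belong to one region. *)
Let MN0 : M *m N = 0.
Proof.
apply/matrixP => i k; rewrite !mxE.
under eq_bigr do rewrite !mxE mulr_sumr.
rewrite exchange_big /=.
have E s : \sum_(a < narcs D)
    ((enum_val i == reg (a, true))%:R + (enum_val i == reg (a, false))%:R) *
    (arc k s == a)%:R = (enum_val i == reg (arc k s, outgoing k s))%:R
      + (enum_val i == reg (arc k s, ~~ outgoing k s))%:R :> 'F_2.
  rewrite (bigD1 (arc k s)) //= eqxx mulr1 big1 ?addr0 => [|a /negPf]; last first.
    by rewrite eq_sym => ->; rewrite mulr0.
  by case: (outgoing k s) => //=; rewrite addrC.
under eq_bigr do rewrite E.
rewrite big_split /= [X in _ + X](reindex_inj (addIr 1)) /=.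
under eq_bigr do rewrite reg_corner.
exact: F2_addrr.
Qed.

Let mul_rVM (f : 'rV['F_2]_#|{: Rg}|) a :
  (f *m M) 0 a = f 0 (enum_rank (reg (a, true))) + f 0 (enum_rank (reg (a, false))).
Proof.
have S u : \sum_j f 0 j * (enum_val j == reg u)%:R = f 0 (enum_rank (reg u)).
  rewrite (bigD1 (enum_rank (reg u))) //= enum_rankK eqxx mulr1 big1 ?addr0 // => j.
  by rewrite -(inj_eq enum_val_inj) enum_rankK => /negPf->; rewrite mulr0.
by rewrite !mxE -!S -big_split; apply: eq_bigr => j _; rewrite !mxE mulrDr.
Qed.

Let connected_const (T : Type) (g : 'I_(narcs D) -> T) :
  (forall k s, g (arc k s) = g (arc k (s + 2))) -> forall a b, g a = g b.
Proof.
move=> H a b; have /connectP[q pq ->] := arcs_connected a b.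
elim: q a pq => //= c q IH a /andP[/existsP[k /existsP[s /andP[/eqP<- /eqP<-]]]].
by move=> /IH <-.
Qed.

Let rank_ker_le1 m n (A : 'M['F_2]_(m, n)) (x : 'rV_m) :
  (forall f : 'rV_m, f *m A = 0 -> exists c, f = c *: x) -> (m <= (\rank A).+1)%N.
Proof.
move=> H; suff /mxrankS: (kermx A <= x)%MS.
  by have := rank_leq_row x; rewrite mxrank_ker; have := rank_leq_row A; lia.
apply/row_subP => i; have [|c ->] := H (row i (kermx A)); last exact: scalemx_sub.
by apply/sub_kermxP; apply: row_sub.
Qed.

(** A left kernel vector has equal values on the two sides of an arc, hence at all corners of a
    crossing, hence on all regions by connectedness. *)
Let rankM : (ncross D < \rank M)%N.
Proof.
suff: (#|{: Rg}| <= (\rank M).+1)%N by rewrite [X in (X <= _)%N]card_Rg.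
apply: (@rank_ker_le1 _ _ _ (const_mx 1)) => f fM0.
pose g u := f 0 (enum_rank (reg u)).
have gE a r : g (a, r) = g (a, true).
  by case: r => //; have := mul_rVM f a; rewrite fM0 mxE => /esym/F2_addr_eq0.
have gS k s : g (arc k s, true) = g (arc k (s + 1), true).
  by rewrite -(gE _ (outgoing k s)) /g reg_corner -/(g _) gE.
have gC := @connected_const _ (fun a => g (a, true)).
exists (g (arc k0 0, true)); apply/rowP => j; rewrite !mxE mulr1.
rewrite -(enum_valK j) -[enum_val j](_ : reg (val (enum_val j)) = _); last first.
  by apply/val_inj/eqP; apply: (valP (enum_val j)).
rewrite -/(g _) [val _]surjective_pairing gE; apply: gC => k s.
by rewrite gS gS -addrA; congr (g (arc k _, _)).
Qed.

(** An arc has one tail and one head, so a kernel vector agrees on the crossings at its two ends,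
    and connectedness makes it constant. *)
Let rankN : (ncross D <= (\rank N).+1)%N.
Proof.
rewrite -mxrank_tr; apply: (@rank_ker_le1 _ _ _ (const_mx 1)) => f fN0.
have ex r a : exists e : 'I_(ncross D) * 'I_4,
    (arc e.1 e.2 == a) && (outgoing e.1 e.2 == r).
  by have [e [ea eo]] := end_exists a r; exists e; rewrite ea eo !eqxx.
pose e r a := xchoose (ex r a).
have eP r a : arc (e r a).1 (e r a).2 = a /\ outgoing (e r a).1 (e r a).2 = r.
  by have /andP[/eqP ? /eqP ?] := xchooseP (ex r a).
move: e eP => e eP.
have fe a : f 0 (e true a).1 = f 0 (e false a).1.
  have: (f *m N^T) 0 a = 0 by rewrite fN0 mxE.
  rewrite mxE; under eq_bigr do rewrite !mxE mulr_sumr.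
  rewrite pair_big /=.
  have ne : e true a != e false a.
    apply/eqP => E; have [_] := eP true a; have [_] := eP false a.
    by rewrite E => ->.
  rewrite (bigD1 (e true a)) // (bigD1 (e false a)) /=; last by rewrite eq_sym.
  have [-> _] := eP true a; have [-> _] := eP false a.
  rewrite eqxx !mulr1 big1 ?addr0 => [/F2_addr_eq0 //|x /andP[x1 x2]].
  case: eqP => [xa|]; rewrite ?mulr0 //.
  case E: (outgoing x.1 x.2).
    by case/eqP: x1; apply: end_unique; have [A O] := eP true a; rewrite ?A ?O.
  by case/eqP: x2; apply: end_unique; have [A O] := eP false a; rewrite ?A ?O.
have fk k s : f 0 k = f 0 (e true (arc k s)).1.
  case E: (outgoing k s); last rewrite fe.
    by rewrite -(@end_unique (k, s) (e true (arc k s))) //;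
      have [A O] := eP true (arc k s); rewrite ?A ?O.
  by rewrite -(@end_unique (k, s) (e false (arc k s))) //;
      have [A O] := eP false (arc k s); rewrite ?A ?O.
exists (f 0 k0); apply/rowP => j; rewrite !mxE mulr1 (fk j 0) (fk k0 0).
apply: (@connected_const _ (fun a => f 0 (e true a).1)) => k s.
by rewrite -!fk.
Qed.

(* Over F_2, [M] is the incidence matrix of regions and arcs and [N] that of arcs and
   crossings. Connectedness makes the left kernel of [M] and the right kernel of [N]
   one-dimensional, so Euler's formula gives im M = ker N, which contains the sum of all
   arcs since every crossing has four ends. *)
Lemma checkerboard : exists phi : 'I_(narcs D) * bool -> bool,
  (forall a r, phi (a, ~~ r) = ~~ phi (a, r)) /\
  (forall k s, phi (arc k s, outgoing k s)
             = phi (arc k (s + 1), ~~ outgoing k (s + 1))).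
Proof.
have MK : (M <= kermx N)%MS by apply/sub_kermxP; exact: MN0.
(* With n crossings, ker N has dimension at most 2n - (n - 1) = n + 1, and M has rank at least n +
   1. *)
have KM : (kermx N <= M)%MS.
  rewrite -(geq_leqif (mxrank_leqif_sup MK)) mxrank_ker.
  by have := rankM; have := rankN; have := narcs_le; lia.
have: ((const_mx 1 : 'rV['F_2]_(narcs D)) <= kermx N)%MS.
  apply/sub_kermxP/rowP => k; rewrite !mxE.
  under eq_bigr do rewrite !mxE mul1r.
  rewrite exchange_big /=.
  under eq_bigr => s _.
    rewrite (bigD1 (arc k s)) //= eqxx big1 ?addr0 => [|a /negPf]; last by rewrite eq_sym => ->.
    over.
  by rewrite sumr_const card_ord; apply/val_inj.
move=> /submx_trans/(_ KM)/submxP[f fE].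
have F2P (x y : 'F_2) : 1 = x + y -> (y == 0) = ~~ (x == 0).
  by case: x => -[|[|//]] i; case: y => -[|[|//]] j.
pose phi u := f 0 (enum_rank (reg u)) == 0; exists phi; split=> [a r|k s].
    have: 1 = (f *m M) 0 a by rewrite -fE mxE.
  rewrite mul_rVM => /F2P; rewrite /phi; case: r => //= ->.
  by rewrite negbK.
by rewrite /phi reg_corner.
Qed.

(* With black on the left of every arc, the arcs around a crossing alternate between
   incoming and outgoing, so every smoothing is oriented and its circles are the cycles of
   a permutation of the arcs. Changing the smoothing composes it with a transposition. *)
Lemma edge_toggles_circles k (v w : vertex D) : is_edge k v w ->
  same_circle w (arc k 0) (arc k 2) = ~~ same_circle v (arc k 0) (arc k 2).
Proof.
case/andP=> vk /eqP wE.
have wk : w k by rewrite wE ffunE eqxx orbT.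
have wj j : j != k -> w j = v j by move=> /negPf jk; rewrite wE ffunE jk orbF.
have [phi [phiN phi_corner]] := checkerboard.
(* The colour on the counterclockwise side of a slot: the direction of the arc there once arcs are
   oriented by colour instead of along the knot. *)
pose out k s := phi (arc k s, outgoing k s).
have outS j s : out j (s + 1) = ~~ out j s by rewrite /out [in RHS]phi_corner phiN negbK.
have outP j r s : out j (partner r s) = ~~ out j s.
  rewrite /partner; case: ifP => _; first exact: outS.
  by have := outS j (s - 1); rewrite subrK => ->; rewrite negbK.
have ex a : exists e : 'I_(ncross D) * 'I_4, (arc e.1 e.2 == a) && ~~ out e.1 e.2.
  have [e [ea eo]] := end_exists a (~~ phi (a, true)).
  exists e; rewrite /out ea eo eqxx /=.
  by case E: (phi (a, true)) => //=; rewrite ?E // (phiN a true) E.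
pose hd a := xchoose (ex a).
have hdP a : arc (hd a).1 (hd a).2 = a /\ out (hd a).1 (hd a).2 = false.
  by have /andP[/eqP ? /negPf ?] := xchooseP (ex a).
move: hd hdP => hd hdP.
have out_unique (e f : 'I_(ncross D) * 'I_4) :
    arc e.1 e.2 = arc f.1 f.2 -> out e.1 e.2 = out f.1 f.2 -> e = f.
  move=> ae oe; apply: end_unique => //; move: oe; rewrite /out ae.
  by case: (outgoing e.1 e.2); case: (outgoing f.1 f.2) => //;
    rewrite (phiN _ true); case: (phi _).
have hdE j s : out j s = false -> hd (arc j s) = (j, s).
  by move=> o; have [A O] := hdP (arc j s); apply: out_unique; rewrite ?A ?O.
(* Enter the crossing at the head of [a] and leave along the smoothing; [partner] flips [out], so
   the arc reached is left through its tail. *)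
pose next u a := arc (hd a).1 (partner (u (hd a).1) (hd a).2).
have next_inj (u : vertex D) : injective (next u).
  move=> a b ab.
  have [Aa Oa] := hdP a; have [Ab Ob] := hdP b.
  have := @out_unique ((hd a).1, partner (u (hd a).1) (hd a).2)
    ((hd b).1, partner (u (hd b).1) (hd b).2) ab.
  rewrite !outP Oa Ob => /(_ erefl)[e1 e2].
  by rewrite -Aa -Ab -e1; congr arc; apply: (can_inj (partnerK (u (hd a).1))); rewrite e2 e1.
pose pi u : {perm 'I_(narcs D)} := perm (next_inj u).
have piE u j s : out j s = false -> pi u (arc j s) = arc j (partner (u j) s).
  by move=> o; rewrite permE /next hdE.
have porbitE u a b : (a \in porbit (pi u) b) = same_circle u b a.
  rewrite -fconnect_perm; apply/idP/idP.
    apply: connect_sub => {a b} a b /eqP <-.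
    have [A O] := hdP a; rewrite -A piE //.
    apply: connect1; apply/existsP; exists (hd a).1.
    by apply/existsP; exists (hd a).2; rewrite !eqxx.
  (* [joined] is symmetric, so half of its steps run against [pi u]. *)
  have sy := fconnect_sym (@perm_inj _ (pi u)).
  apply: connect_sub => {a b} a b /existsP[j /existsP[s /andP[/eqP<- /eqP<-]]].
  case E: (out j s); last by apply: connect1; rewrite /= piE.
  rewrite sy; apply: connect1; rewrite /= piE ?outP ?E //.
  by rewrite partnerK.
have [s0 s0P o0] : exists2 s0, s0 = 0 \/ s0 = 1 & out k s0 = false.
  case E: (out k 0); first by exists 1; [right | rewrite -[1](add0r 1) outS E].
  by exists 0; first left.
have o2 : out k (s0 + 2) = false.
  by rewrite (_ : s0 + 2 = s0 + 1 + 1) ?outS ?o0 // -addrA; congr (_ + _); apply/val_inj.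
set A := arc k s0; set B := arc k (s0 + 2).
have AB : A != B.
  apply/eqP => E; have := @out_unique (k, s0) (k, s0 + 2) E.
  by rewrite /= o0 o2 => /(_ erefl)[] /eqP; case: s0P => ->.
(* [A] and [B] are the two arcs entering [k]; changing the smoothing exchanges their
   continuations. *)
have piw : pi w = (tperm A B * pi v)%g.
  apply/permP => a; rewrite permM.
  have [-> | aA] := eqVneq a A.
    rewrite tpermL !piE // wk (negPf vk).
    by case: (partner_addl s0) => -> _ _.
  have [-> | aB] := eqVneq a B.
    rewrite tpermR !piE // wk (negPf vk).
    by case: (partner_addl s0) => _ -> _.
  rewrite tpermD 1?eq_sym //.
  have [Aa Oa] := hdP a; rewrite -Aa !piE // wj //.
  apply/eqP => hk; move: aA aB Aa Oa; rewrite hk /A /B; move: (hd a).2 => t aA aB Aa.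
  move: aA aB; rewrite -{}Aa.
  have E1 : out k 1 = ~~ out k 0 by rewrite -[1]add0r outS.
  have E2 : out k 2 = ~~ out k 1 by rewrite -outS; congr out; apply/val_inj.
  have E3 : out k 3 = ~~ out k 2 by rewrite -outS; congr out; apply/val_inj.
  have E12 : 1 + 2 = 3 :> 'I_4 by apply/val_inj.
  by case: s0P o0 => ->; case: (slotP t) => ->;
    rewrite ?add0r ?E12 ?E3 ?E2 ?E1 ?eqxx //;
    case: (out k 0).
have key : same_circle w A B = ~~ same_circle v A B.
  rewrite !(same_circle_sym _ A) -!porbitE piw.
  have := porbits_mul_tperm (pi v) A B; have := porbits_mul_tperm (tperm A B * pi v)%g A B.
  rewrite /= mulgA tperm2 mul1g AB => H1 H2; exact: toggle_count H2 H1.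
have J u s : same_circle u (arc k s) (arc k (partner (u k) s)).
  by apply: connect1; apply/existsP; exists k; apply/existsP; exists s; rewrite !eqxx.
have jv s : same_circle v (arc k s) (arc k (partner false s)) by rewrite -(negPf vk).
have jw s : same_circle w (arc k s) (arc k (partner true s)) by rewrite -wk.
(* If the incoming slots are 1 and 3, the smoothings carry them to 0 and 2: [v] joins 0,1 and 2,3,
   while [w] joins 1,2 and 3,0. *)
case: s0P key; rewrite /A /B => ->; first by rewrite add0r.
have := jv 0; rewrite (_ : partner _ _ = 1); last exact/val_inj.
have := jv 2; rewrite (_ : partner _ _ = 3); last exact/val_inj.
have := jw 0; rewrite (_ : partner _ _ = 3); last exact/val_inj.
have := jw 2; rewrite (_ : partner _ _ = 1); last exact/val_inj.
rewrite (_ : 1 + 2 = 3); last exact/val_inj.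
move=> w2 w0 v2 v0.
rewrite (same_circleW _ v0) (same_circleW _ w0) ![same_circle _ _ (arc k 2)]same_circle_sym.
rewrite (same_circleW _ v2) (same_circleW _ w2) same_circle_sym => ->.
by rewrite same_circle_sym.
Qed.
End Planarity.

(** * Circles of adjacent resolutions *)

Section Circles.
Variable D : diagram.
Implicit Types (u v w : vertex D) (k l : 'I_(ncross D)) (s : 'I_4).
Implicit Types (a b : 'I_(narcs D)).

Definition croot v a := fingraph.root (joined v) a.
Definition croots v : pred 'I_(narcs D) := roots (joined v).

Lemma same_circle_refl v a : same_circle v a a.
Proof. exact: connect0. Qed.

Lemma croot_circle v a : same_circle v a (croot v a).
Proof. exact: connect_root. Qed.

Lemma croots_root v a : croots v (croot v a).
Proof. exact: roots_root (same_circle_sym v) a. Qed.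

Lemma croot_id v a : croots v a -> croot v a = a.
Proof. by move/eqP. Qed.

Lemma croot_eq v a b : (croot v a == croot v b) = same_circle v a b.
Proof. exact: (root_connect (same_circle_sym v)). Qed.

Lemma croots_eq v r a : croots v r -> (r == croot v a) = same_circle v r a.
Proof. by move=> /eqP {1}<-; apply: croot_eq. Qed.

Lemma joined_slot v k s : same_circle v (arc k s) (arc k (partner (v k) s)).
Proof. by apply: connect1; apply/existsP; exists k; apply/existsP; exists s; rewrite !eqxx. Qed.

Lemma const_circle (T : Type) (f : 'I_(narcs D) -> T) v :
  (forall k s, f (arc k s) = f (arc k (partner (v k) s))) ->
  forall a b, same_circle v a b -> f a = f b.
Proof.
move=> fc a b /connectP[q pq ->]; elim: q a pq => //= c q IH a.
by case/andP=> /existsP[k /existsP[s /andP[/eqP<- /eqP<-]]] /IH <-.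
Qed.

Definition touches v k a := same_circle v a (arc k 0) || same_circle v a (arc k 2).

(** Either smoothing joins the slots 1 and 3 to the slots 0 and 2, so the latter see every circle
    through the crossing. *)
Lemma touches_slot v k s : touches v k (arc k s).
Proof.
rewrite /touches; have := joined_slot v k s.
have [E1 E2] : partner true 1 = 2 /\ partner false 1 = 0 by split; apply/val_inj.
have [E3 E4] : partner true 3 = 0 /\ partner false 3 = 2 by split; apply/val_inj.
by case: (slotP s) => ->; rewrite ?same_circle_refl ?orbT //; case: (v k);
  rewrite ?E1 ?E2 ?E3 ?E4 => ->; rewrite ?orbT.
Qed.

Lemma touches_circle v k a b : same_circle v a b -> touches v k a = touches v k b.
Proof. by move=> ab; rewrite /touches !(same_circleW _ ab). Qed.

(** [w] has a single circle through [k]. No direction is fixed for the edge between [u] and [w], so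
    that the section serves merges (from [u]) and splits (from [w]) alike. *)
Section Coarsening.
Variables (u w : vertex D) (k : 'I_(ncross D)).
Hypothesis uw : forall j, j != k -> u j = w j.
Hypothesis w02 : same_circle w (arc k 0) (arc k 2).

Lemma coarse_slot s : same_circle w (arc k s) (arc k 0).
Proof.
case/orP: (touches_slot w k s) => // H.
by rewrite same_circle_sym (same_circleW _ w02) same_circle_sym.
Qed.

Lemma coarse_sub a b : same_circle u a b -> same_circle w a b.
Proof.
apply: connect_sub => {a b} a b /existsP[j /existsP[s /andP[/eqP<- /eqP<-]]].
have [->|jk] := eqVneq j k; last by rewrite uw //; apply: joined_slot.
by rewrite [connect _ _ _](same_circleW _ (coarse_slot s)) same_circle_sym coarse_slot.
Qed.

Lemma coarse_circle a b :
  same_circle w a b = same_circle u a b || (touches u k a && touches u k b).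
Proof.
apply/idP/orP => [|[/coarse_sub //|/andP[ta tb]]]; last first.
  have T c : touches u k c -> same_circle w c (arc k 0).
    by case/orP => /coarse_sub // H; rewrite (same_circleW _ H) coarse_slot.
  by rewrite (same_circleW _ (T _ ta)) same_circle_sym T.
move=> ab; pose S := [pred c | same_circle u a c || (touches u k a && touches u k c)].
suff cl : closed (joined w) S.
  by have := closed_connect cl ab; rewrite !inE same_circle_refl /= => /esym/orP.
apply: intro_closed => [|b' c]; first exact/sym_connect_sym/joined_sym.
move=> /existsP[j /existsP[s /andP[/eqP<- /eqP<-]]]; rewrite !inE.
have [->|jk] := eqVneq j k.
  by rewrite !touches_slot !andbT => /orP[/touches_circle-> | ->];
    rewrite ?touches_slot orbT.
rewrite -uw //; have H := joined_slot u j s.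
by rewrite !(same_circle_sym _ a) (same_circleW _ H) (touches_circle _ H).
Qed.

Lemma coarse_touches a : same_circle w a (arc k 0) = touches u k a.
Proof.
rewrite coarse_circle touches_slot andbT.
by rewrite /touches; case: (same_circle u a (arc k 0)).
Qed.

(** The root is picked from the set of arcs of a circle, and away from [k] this set is the same in
    both resolutions. *)
Lemma coarse_croots r : ~~ touches u k r -> croots u r = croots w r.
Proof.
move=> nt; suff E : croot u r = croot w r.
  by rewrite /croots /roots -/(croot u r) E.
have E : pick (connect (joined u) r) = pick (connect (joined w) r).
  by apply: eq_pick => b; rewrite [RHS]coarse_circle (negPf nt) orbF.
by rewrite /croot /fingraph.root E.
Qed.

End Coarsening.

#[local] Opaque same_circle croot croots.

Section CoarseningBig.
Variables (u w : vertex D) (k : 'I_(ncross D)).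
Hypothesis uw : forall j, j != k -> u j = w j.
Hypothesis w02 : same_circle w (arc k 0) (arc k 2).
Hypothesis u02 : ~~ same_circle u (arc k 0) (arc k 2).

Section Big.
Variables (T : Type) (idx : T) (op : Monoid.com_law idx) (f : 'I_(narcs D) -> T).

(** Here and in [big_fine] the circles away from [k] are indexed by the same roots, so the two
    products can be compared factor by factor. *)
Lemma big_coarse : \big[op/idx]_(r | croots w r) f r =
  op (f (croot w (arc k 0))) (\big[op/idx]_(r | croots w r && ~~ touches u k r) f r).
Proof.
rewrite (bigD1 (croot w (arc k 0))) ?croots_root //=; congr (op _ _).
apply: eq_bigl => r; case rr: (croots w r) => //=.
by rewrite croots_eq // (coarse_touches uw w02).
Qed.

Lemma big_fine : \big[op/idx]_(r | croots u r) f r =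
  op (f (croot u (arc k 0))) (op (f (croot u (arc k 2)))
  (\big[op/idx]_(r | croots w r && ~~ touches u k r) f r)).
Proof.
rewrite (bigD1 (croot u (arc k 0))) ?croots_root //=.
rewrite (bigD1 (croot u (arc k 2))) ?croots_root /=; last first.
  by rewrite croot_eq same_circle_sym.
congr (op _ (op _ _)); apply: eq_bigl => r; rewrite -andbA.
case ru: (croots u r); last first.
  case: (boolP (touches u k r)) => nt; first by rewrite andbF.
  by rewrite -(coarse_croots uw w02 nt) ru.
rewrite andTb !(croots_eq _ ru) -negb_or -/(touches u k r).
case: (boolP (touches u k r)) => nt; first by rewrite andbF.
by rewrite -(coarse_croots uw w02 nt) ru.
Qed.
End Big.

Lemma ncircles_coarse : ncircles u = (ncircles w).+1.
Proof.
have E v : ncircles v = (\sum_(r | croots v r) 1)%N.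
  by rewrite sum1_card; apply: eq_card => r; rewrite !inE andbT.
by rewrite !E big_coarse big_fine.
Qed.
End CoarseningBig.

(** Reading [f] at the root of each circle turns an arbitrary function into a legitimate
    labelling. *)
Lemma mkstate_subproof v (f : 'I_(narcs D) -> bool) :
  [forall a, forall b, same_circle v a b ==>
    ([ffun a => f (croot v a)] a == [ffun a => f (croot v a)] b)].
Proof.
apply/forallP => a; apply/forallP => b; apply/implyP => ab; rewrite !ffunE.
by move: ab; rewrite -croot_eq => /eqP ->.
Qed.
Definition mkstate v f : state D := exist _ (v, _) (mkstate_subproof v f).

Lemma lab_mkstate v f a : lab (mkstate v f) a = f (croot v a).
Proof. by rewrite /lab ffunE. Qed.

Lemma lab_mkstate_const v f a : (forall a b, same_circle v a b -> f a = f b) ->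
  lab (mkstate v f) a = f a.
Proof. by move=> H; rewrite lab_mkstate; apply: H; rewrite same_circle_sym croot_circle. Qed.

Lemma state_eq (x y : state D) : res x = res y -> lab x =1 lab y -> x = y.
Proof.
move=> r l; apply/val_inj; rewrite [LHS]surjective_pairing [RHS]surjective_pairing.
by congr pair => //; apply/ffunP => a; apply: l.
Qed.

Lemma lab_croot (x : state D) a : lab x (croot (res x) a) = lab x a.
Proof. by apply: lab_circle; rewrite same_circle_sym croot_circle. Qed.

(** States over [v] are arbitrary labellings of its circles, so this is distributivity. It reduces
    sums over states to one circle at a time. *)
Lemma state_sum (R : comNzRingType) v (G : 'I_(narcs D) -> bool -> R) :
  \sum_(y : state D | res y == v) \prod_(r | croots v r) G r (lab y r) =
  \prod_(r | croots v r) \sum_b G r b.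
Proof.
rewrite (big_distr_big false) /=.
(* The functions in the distributed sum are supported on the roots, hence the value [false]
   elsewhere. *)
pose h (y : state D) : {ffun 'I_(narcs D) -> bool} := [ffun a => croots v a && lab y a].
pose h' (f : {ffun 'I_(narcs D) -> bool}) := mkstate v f.
rewrite (reindex_onto h h') => [|f]; last first.
  move=> /pfamilyP[/subsetP fs _]; apply/ffunP => a; rewrite ffunE lab_mkstate.
  case ra: (croots v a); first by rewrite croot_id.
  apply/esym/negbTE/negP => fa; suff: croots v a by rewrite ra.
  by apply: fs; rewrite inE fa.
apply: eq_big => [y|y /eqP ry]; last first.
  by apply: eq_bigr => r rr; rewrite ffunE rr.
apply/eqP/andP => [ry|[_ /eqP <-] //]; split.
  apply/pfamilyP; split=> // ; apply/subsetP => a.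
  by rewrite inE ffunE -[_ \in _]/(croots v a); case: (croots v a).
apply/eqP/state_eq => // a; rewrite lab_mkstate ffunE croots_root /=.
by rewrite -ry lab_croot.
Qed.

End Circles.

(** * Diagonalization of the differential *)

Section LocalSums.
Variables (R : comNzRingType) (D : diagram) (val : bool -> R).
Implicit Types (u v w : vertex D) (k l : 'I_(ncross D)) (s : 'I_4).
Implicit Types (a b q : 'I_(narcs D)) (f g : 'I_(narcs D) -> bool).

(** The basis element with labels [f], as a monomial in the circle variables, evaluated at the point
    with coordinate [val (g r)] on the circle [r]. *)
Definition monomial v f g : R :=
  \prod_(r | croots v r) (if f r then val (g r) else 1).

(** Writing the condition as a product over circles brings it into the form required by
    [state_sum]. *)
Lemma agree_prod v (Q : pred 'I_(narcs D)) f (y : state D) : res y = v ->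
  (forall a b, same_circle v a b -> Q a = Q b) ->
  (forall a b, same_circle v a b -> ~~ Q a -> f a = f b) ->
  [forall a, Q a || (f a == lab y a)]%:R =
    \prod_(r | croots v r && ~~ Q r) (f r == lab y r)%:R :> R.
Proof.
move=> ry Qc fc; case: forallP => [H|/forallP].
  rewrite big1 // => r /andP[_ /negPf Qr].
  by move: (H r); rewrite Qr /= => ->.
rewrite negb_forall => /existsP[a]; rewrite negb_or => /andP[Qa fa].
have aa := croot_circle v a.
rewrite (bigD1 (croot v a)) /=; last by rewrite croots_root -(Qc _ _ aa).
by rewrite -(fc _ _ aa Qa) -[in lab _ _]ry lab_croot (negPf fa) mul0r.
Qed.

Lemma same_croot v q a : same_circle v (croot v q) a = same_circle v q a.
Proof. by rewrite -(same_circleW a (croot_circle v q)). Qed.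

Lemma prod_split1 v q (F : 'I_(narcs D) -> R) :
  \prod_(r | croots v r) F r =
  F (croot v q) * \prod_(r | croots v r && ~~ same_circle v r q) F r.
Proof.
rewrite (bigD1 (croot v q)) ?croots_root //=; congr (_ * _).
by apply: eq_bigl => r; case rr: (croots v r) => //=; rewrite croots_eq.
Qed.

Lemma prod_split2 v q q' (F : 'I_(narcs D) -> R) : ~~ same_circle v q q' ->
  \prod_(r | croots v r) F r = F (croot v q) * F (croot v q')
  * \prod_(r | croots v r && ~~ (same_circle v r q || same_circle v r q')) F r.
Proof.
move=> qq'; rewrite (prod_split1 v q) -mulrA; congr (_ * _).
rewrite (bigD1 (croot v q')) ?croots_root //=; last first.
  by rewrite same_croot same_circle_sym.
congr (_ * _); apply: eq_bigl => r.
by case rr: (croots v r) => //=; rewrite croots_eq // negb_or.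
Qed.

Lemma sum_delta (d : bool) (x : bool -> R) :
  \sum_e (d == e)%:R * x e = x d.
Proof. by rewrite big_bool; case: d; rewrite /= !(mul0r, mul1r, addr0, add0r). Qed.

(** [W] is a row of a local operator on the circle of [q]; on the other circles Kronecker deltas
    copy the labels. [local_sum2] is the version with two output circles. *)
Lemma local_sum1 v q (W : bool -> R) f g :
  (forall a b, same_circle v a b -> ~~ same_circle v a q -> f a = f b) ->
  \sum_(y : state D | res y == v)
     [forall a, same_circle v a q || (f a == lab y a)]%:R * W (lab y q)
       * monomial v (lab y) g
  = (\sum_e W e * (if e then val (g (croot v q)) else 1))
    * \prod_(r | croots v r && ~~ same_circle v r q) (if f r then val (g r) else 1).
Proof.
move=> fc.
pose G r e := (if same_circle v r q then W e else (f r == e)%:R)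
              * (if e then val (g r) else 1).
transitivity (\prod_(r | croots v r) \sum_e G r e).
  rewrite -state_sum; apply: eq_bigr => y /eqP ry; rewrite /G big_split; congr (_ * _).
  rewrite (@agree_prod v) // => [|a b ab]; last exact: same_circleW.
  rewrite (prod_split1 v q) same_croot same_circle_refl mulrC.
  rewrite -[in RHS]ry lab_croot ry; congr (_ * _).
  by apply: eq_bigr => r /andP[_ /negPf ->].
rewrite (prod_split1 v q) /G same_croot same_circle_refl; congr (_ * _).
by apply: eq_bigr => r /andP[_ /negPf ->]; rewrite sum_delta.
Qed.

Lemma local_sum2 v q q' (W : bool -> bool -> R) f g : ~~ same_circle v q q' ->
  (forall a b, same_circle v a b ->
     ~~ (same_circle v a q || same_circle v a q') -> f a = f b) ->
  \sum_(y : state D | res y == v)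
     [forall a, same_circle v a q || same_circle v a q' || (f a == lab y a)]%:R
       * W (lab y q) (lab y q') * monomial v (lab y) g
  = (\sum_e \sum_e' W e e' * ((if e then val (g (croot v q)) else 1)
                         * (if e' then val (g (croot v q')) else 1)))
    * \prod_(r | croots v r && ~~ (same_circle v r q || same_circle v r q'))
        (if f r then val (g r) else 1).
Proof.
move=> qq' fc.
have q'q : same_circle v q' q = false by rewrite same_circle_sym (negPf qq').
pose G e e' r d := (if same_circle v r q then (e == d)%:R else
  if same_circle v r q' then (e' == d)%:R else (f r == d)%:R)
              * (if d then val (g r) else 1).
transitivity (\sum_e \sum_e' W e e' * \prod_(r | croots v r) \sum_d G e e' r d).
  under [RHS]eq_bigr do under eq_bigr do rewrite -state_sum mulr_sumr.
  under [RHS]eq_bigr do rewrite exchange_big.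
  rewrite [RHS]exchange_big /=; apply: eq_bigr => y /eqP ry.
  (* [W] couples two circles; expanding it in deltas makes each term a product over circles. *)
  have -> : W (lab y q) (lab y q') =
      \sum_e \sum_e' W e e' * ((e == lab y q)%:R * (e' == lab y q')%:R).
    by rewrite !big_bool /=; case: (lab y q); case: (lab y q'); rewrite /=; ring.
  rewrite mulr_sumr mulr_suml; apply: eq_bigr => e _.
  rewrite mulr_sumr mulr_suml; apply: eq_bigr => e' _.
  rewrite mulrCA -mulrA; congr (_ * _); rewrite /G big_split; congr (_ * _).
  rewrite (@agree_prod v (fun a => same_circle v a q || same_circle v a q')) // => [|a a' aa'];
    last by rewrite !(same_circleW _ aa').
  rewrite mulrC (prod_split2 _ qq') !same_croot !same_circle_refl q'q.
  rewrite -[in RHS]ry !lab_croot ry; congr (_ * _).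
  by apply: eq_bigr => r /andP[_ /norP[/negPf-> /negPf->]].
rewrite mulr_suml; apply: eq_bigr => e _.
rewrite mulr_suml; apply: eq_bigr => e' _; rewrite -mulrA; congr (_ * _).
rewrite (prod_split2 _ qq') /G !same_croot !same_circle_refl q'q !sum_delta.
congr (_ * _).
by apply: eq_bigr => r /andP[_ /norP[/negPf-> /negPf->]]; rewrite sum_delta.
Qed.

End LocalSums.

#[local] Opaque same_circle croot croots lab ncircles.

Section EdgeCoef.
Variables (R : comNzRingType) (A : frobenius R) (D : diagram).
Implicit Types (x y z : state D) (k l : 'I_(ncross D)).

Definition agree_away k x y : bool :=
  [forall a, touches (res x) k a || (lab x a == lab y a)].

Lemma edge_coef_merge k x y :
  ~~ same_circle (res x) (arc k 0) (arc k 2) ->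
  same_circle (res y) (arc k 0) (arc k 2) ->
  edge_coef A k x y = (agree_away k x y)%:R *
    fmul A (lab x (arc k 0)) (lab x (arc k 2)) (lab y (arc k 0)).
Proof.
rewrite /edge_coef /agree_away => /negPf-> ->.
have -> : [forall a, [|| same_circle (res x) a (arc k 0), same_circle (res x) a (arc k 2)
    | lab x a == lab y a]] = [forall a, touches (res x) k a || (lab x a == lab y a)].
  by apply: eq_forallb => a; rewrite orbA.
by case: ifP; rewrite ?mul1r ?mul0r.
Qed.

Lemma edge_coef_split k x y :
  same_circle (res x) (arc k 0) (arc k 2) ->
  ~~ same_circle (res y) (arc k 0) (arc k 2) ->
  edge_coef A k x y = (agree_away k x y)%:R *
    fcomul A (lab x (arc k 0)) (lab y (arc k 0)) (lab y (arc k 2)).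
Proof.
rewrite /edge_coef /agree_away => -> /negPf->.
have -> : [forall a, [|| same_circle (res x) a (arc k 0), same_circle (res x) a (arc k 2)
    | lab x a == lab y a]] = [forall a, touches (res x) k a || (lab x a == lab y a)].
  by apply: eq_forallb => a; rewrite orbA.
by case: ifP; rewrite ?mul1r ?mul0r.
Qed.
End EdgeCoef.

Lemma is_edge_neq (D : diagram) k (v w : vertex D) :
  is_edge k v w -> forall j, j != k -> v j = w j.
Proof. by case/andP=> _ /eqP-> j /negPf jk; rewrite ffunE jk orbF. Qed.

Section Evaluation.
Variables (R : comNzRingType) (D : diagram) (val : bool -> R).
Implicit Types (u v w : vertex D) (k l : 'I_(ncross D)) (x y z s : state D).

Let A := quadratic_frobenius (val true + val false) (- (val true * val false)).
(** The derivative at the root [val e] of the quadratic polynomial defining [A]. *)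
Definition root_gap e : R := val e - val (~~ e).

Let qmul_val a b d :
  \sum_e fmul A a b e * (if e then val d else 1)
  = (if a then val d else 1) * (if b then val d else 1).
Proof. by rewrite big_bool /=; case: a; case: b; case: d; rewrite /qmul /=; ring. Qed.

(** Delta(1) = X (x) 1 + 1 (x) X - h vanishes at a pair of opposite roots, whose sum is h, and
    equals the gap on the diagonal. *)
Let qcomul_val a d e :
  \sum_b \sum_c fcomul A a b c * ((if b then val d else 1) * (if c then val e else 1))
  = if d == e then root_gap d * (if a then val d else 1) else 0.
Proof.
by rewrite !big_bool /= /root_gap; case: a; case: d; case: e; rewrite /qcomul /=; ring.
Qed.

(** From here on planarity enters only in this form. *)
Hypothesis toggle : forall k v w, is_edge k v w ->
  same_circle w (arc k 0) (arc k 2) = ~~ same_circle v (arc k 0) (arc k 2).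

Lemma eval_merge k x z : is_edge k (res x) (res z) ->
  ~~ same_circle (res x) (arc k 0) (arc k 2) ->
  \sum_(y | res y == res z) edge_coef A k x y * monomial val (res z) (lab y) (lab z)
  = monomial val (res x) (lab x) (lab z).
Proof.
move=> ed x02; have z02 : same_circle (res z) (arc k 0) (arc k 2) by rewrite (toggle ed).
have uw := is_edge_neq ed.
have tE := coarse_touches uw z02.
under eq_bigr => y /eqP ry.
  rewrite edge_coef_merge ?ry // /agree_away.
  under eq_forallb do rewrite -tE.
  over.
rewrite (local_sum1 val (fmul A (lab x (arc k 0)) (lab x (arc k 2)))) => [|a b ab]; last first.
  rewrite tE => ta; apply: lab_circle; move: ab.
  by rewrite (coarse_circle uw z02) (negPf ta) orbF.
rewrite qmul_val (lab_croot z) /monomial [RHS](big_fine uw z02 x02).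
rewrite !(lab_croot x) /= mulrA.
have zr a : same_circle (res z) a (arc k 0) -> lab z (croot (res x) a) = lab z (arc k 0).
  move=> H; rewrite -(lab_circle H); apply: lab_circle; apply: (coarse_sub uw z02).
  by rewrite same_circle_sym croot_circle.
rewrite !zr ?same_circle_refl //; last by rewrite same_circle_sym.
by congr (_ * _); apply: eq_bigl => r; rewrite tE.
Qed.

Lemma eval_split k x z : is_edge k (res x) (res z) ->
  same_circle (res x) (arc k 0) (arc k 2) ->
  \sum_(y | res y == res z) edge_coef A k x y * monomial val (res z) (lab y) (lab z)
  = if lab z (arc k 0) == lab z (arc k 2)
    then root_gap (lab z (arc k 0)) * monomial val (res x) (lab x) (lab z) else 0.
Proof.
move=> ed x02; have z02 : ~~ same_circle (res z) (arc k 0) (arc k 2) by rewrite (toggle ed) x02.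
have uw j (jk : j != k) : (res z) j = (res x) j by rewrite (is_edge_neq ed).
have tE a : touches (res x) k a = touches (res z) k a.
  rewrite -(coarse_touches uw x02) {1}/touches; have := same_circleW a x02.
  by rewrite ![same_circle _ _ a]same_circle_sym => <-; rewrite orbb.
under eq_bigr => y /eqP ry.
  rewrite edge_coef_split ?ry // /agree_away.
  under eq_forallb do rewrite tE.
  over.
rewrite (local_sum2 val (fcomul A (lab x (arc k 0)))) // => [|a b ab _]; last first.
  by apply: lab_circle; apply: (coarse_sub uw x02).
rewrite qcomul_val !lab_croot; case: eqP => [E|_]; last by rewrite mul0r.
rewrite -mulrA; congr (_ * _).
rewrite /monomial (big_coarse uw x02) lab_croot /=.
have -> : lab z (croot (res x) (arc k 0)) = lab z (arc k 0); last first.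
  congr (_ * _); apply: eq_bigl => r; rewrite -/(touches (res z) k r).
  case: (boolP (touches (res z) k r)) => nt; first by rewrite !andbF.
  by rewrite (coarse_croots uw x02 nt).
have := croot_circle (res x) (arc k 0); rewrite (coarse_circle uw x02) => /orP[/lab_circle -> //|].
by case/andP=> _ /orP[] /lab_circle -> //.
Qed.

(* Evaluating the circle variables at the roots [val] of X^2 - h X - t: this is the change
   to the idempotent basis of A, in which the differential does not change labels. *)
Definition evaluate (c : chain R D) : chain R D :=
  [ffun s => \sum_(x | res x == res s) c x * monomial val (res s) (lab x) (lab s)].

Definition diag_coef k x z : R :=
  if [forall a, lab x a == lab z a] then
    if same_circle (res x) (arc k 0) (arc k 2) then root_gap (lab z (arc k 0)) else 1
  else 0.

Definition diag_dcoef x z : R :=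
  \sum_(k | is_edge k (res x) (res z)) edge_sign R k (res x) * diag_coef k x z.

Definition diag_differential (c : chain R D) : chain R D :=
  [ffun z => \sum_x c x * diag_dcoef x z].

Lemma eval_edge k x z : is_edge k (res x) (res z) ->
  \sum_(y | res y == res z) edge_coef A k x y * monomial val (res z) (lab y) (lab z)
  = \sum_(s | res s == res x) monomial val (res x) (lab x) (lab s) * diag_coef k s z.
Proof.
move=> ed.
(* The labels of [z] define a state over [res x] unless the edge splits a circle into two with
   different roots. *)
have constz :
    ~~ same_circle (res x) (arc k 0) (arc k 2) || (lab z (arc k 0) == lab z (arc k 2)) ->
    forall a b, same_circle (res x) a b -> lab z a = lab z b.
  case x02: (same_circle (res x) (arc k 0) (arc k 2)); last first.
    move=> _ a b ab; apply: lab_circle; apply: (coarse_sub (is_edge_neq ed)) ab.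
    by rewrite (toggle ed) x02.
  move=> /eqP E a b ab.
  have uw j (jk : j != k) : (res z) j = (res x) j by rewrite (is_edge_neq ed).
  have T c : touches (res z) k c -> lab z c = lab z (arc k 0).
    by case/orP=> /lab_circle ->.
  by move: ab; rewrite (coarse_circle uw x02) => /orP[/lab_circle //|/andP[/T -> /T ->] //].
have single : (forall a b, same_circle (res x) a b -> lab z a = lab z b) ->
    \sum_(s | res s == res x) monomial val (res x) (lab x) (lab s) * diag_coef k s z
    = monomial val (res x) (lab x) (lab z) *
      if same_circle (res x) (arc k 0) (arc k 2) then root_gap (lab z (arc k 0)) else 1.
  move=> zc; pose s0 := mkstate (res x) (lab z).
  have Es0 : lab s0 =1 lab z by move=> a; apply: lab_mkstate_const.
  rewrite (bigD1 s0) //= big1 ?addr0 => [|s /andP[/eqP rs ss0]]; last first.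
    rewrite /diag_coef; case: forallP => [H|_]; last by rewrite mulr0.
    by case/eqP: ss0; apply: state_eq => // a; rewrite Es0; apply/eqP.
  rewrite /diag_coef; case: forallP => [_|[]]; last by move=> a; rewrite Es0.
  congr (_ * _); apply: eq_bigr => r _; by rewrite Es0.
case x02: (same_circle (res x) (arc k 0) (arc k 2)); last first.
  by rewrite eval_merge ?x02 // single ?x02 ?mulr1 //; apply: constz; rewrite x02.
rewrite eval_split //; case: ifP => [E|/negP E].
  by rewrite single ?x02 1?mulrC //; apply: constz; rewrite E orbT.
(* The two new circles carry different roots: no state over [res x] has the labels of [z], so both
   sides vanish. *)
rewrite big1 // => s /eqP rs; rewrite /diag_coef; case: forallP => [H|_]; last by rewrite mulr0.
case: E; rewrite -(eqP (H _)) -(eqP (H _)); apply/eqP/lab_circle.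
by rewrite rs.
Qed.

Lemma evaluate_differential (c : chain R D) :
  evaluate (differential A c) = diag_differential (evaluate c).
Proof.
apply/ffunP => z; rewrite !ffunE.
under eq_bigr do rewrite ffunE mulr_suml.
under [RHS]eq_bigr do rewrite ffunE mulr_suml.
rewrite exchange_big /= [RHS]pair_big_dep /=.
rewrite (reindex (fun p : state D * state D => (p.2, p.1))) /=; last first.
  by exists (fun p => (p.2, p.1)); case.
rewrite -(pair_big_dep xpredT (fun x s => res x == res s)
  (fun x s => c x * monomial val (res s) (lab x) (lab s) * diag_dcoef s z)) /=.
apply: eq_bigr => x _.
transitivity (c x * \sum_(k | is_edge k (res x) (res z)) edge_sign R k (res x) *
  \sum_(y | res y == res z) edge_coef A k x y * monomial val (res z) (lab y) (lab z)).
  rewrite mulr_sumr; under [RHS]eq_bigr do rewrite mulr_sumr mulr_sumr.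
  rewrite [RHS]exchange_big /=; apply: eq_bigr => y /eqP ry.
  rewrite /dcoef ry mulr_sumr mulr_suml; apply: eq_bigr => k _.
  by rewrite !mulrA.
rewrite (eq_bigr _ (fun k ed => congr1 ( *%R _) (eval_edge ed))).
rewrite mulr_sumr; under [LHS]eq_bigr do rewrite mulr_sumr mulr_sumr.
rewrite exchange_big /=; apply: eq_big => [s|s /eqP rs]; first exact: eq_sym.
rewrite /diag_dcoef rs mulr_sumr; apply: eq_bigr => k _.
ring.
Qed.

Lemma evaluate_Xact p (c : chain R D) s :
  evaluate (Xact A p c) s = val (lab s p) * evaluate c s.
Proof.
rewrite !ffunE; under eq_bigr do rewrite ffunE mulr_suml.
rewrite exchange_big /= mulr_sumr (bigID (fun x => res x == res s)) /=.
rewrite [X in _ + X]big1 ?addr0 => [|x xs]; last first.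
  rewrite big1 // => y /eqP ys; rewrite /Xcoef ys (negPf xs) mulr0 mul0r //.
apply: eq_bigr => x /eqP xs; rewrite mulrCA.
under eq_bigr do rewrite -mulrA.
rewrite -mulr_sumr; congr (_ * _).
transitivity (\sum_(y : state D | res y == res s)
     [forall a, same_circle (res s) a p || (lab x a == lab y a)]%:R
       * fmul A true (lab x p) (lab y p)
       * monomial val (res s) (lab y) (lab s)).
  apply: eq_bigr => y /eqP ry; rewrite /Xcoef xs ry eqxx /=.
  by case: forallP => _; rewrite ?mul1r ?mul0r.
rewrite (local_sum1 val (fmul A true (lab x p))) => [|a b ab _]; last first.
  by apply: lab_circle; rewrite xs.
rewrite qmul_val lab_croot /monomial (prod_split1 _ p) -mulrA lab_croot.
by rewrite -[in lab x (croot _ _)]xs lab_croot.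
Qed.
End Evaluation.

(** * The diagonal differential squares to zero *)

Section DiagSquare.
Variables (R : comNzRingType) (D : diagram) (val : bool -> R).
Implicit Types (u v w : vertex D) (k l : 'I_(ncross D)) (x y z s : state D).

Hypothesis toggle : forall k v w, is_edge k v w ->
  same_circle w (arc k 0) (arc k 2) = ~~ same_circle v (arc k 0) (arc k 2).

Definition flip k v : vertex D := [ffun j => v j || (j == k)].

Lemma is_edge_flip k v : ~~ v k -> is_edge k v (flip k v).
Proof. by rewrite /is_edge => ->; rewrite eqxx. Qed.

Lemma ncircles_edge k v w : is_edge k v w ->
  let S := same_circle v (arc k 0) (arc k 2) in
  (ncircles w + ~~ S = ncircles v + S)%N.
Proof.
move=> ed S; rewrite {}/S; have uw := is_edge_neq ed.
case v02: (same_circle v (arc k 0) (arc k 2)).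
  have -> : ncircles w = (ncircles v).+1.
    apply: (@ncircles_coarse _ w v k) => // [j jk|]; first by rewrite uw.
    by rewrite (toggle ed) v02.
  by rewrite addn0 addn1.
have -> : ncircles v = (ncircles w).+1.
  by apply: (@ncircles_coarse _ v w k); rewrite ?v02 // (toggle ed) v02.
by rewrite addn0 addn1.
Qed.

Lemma edge_sign_flip k l v : ~~ v k ->
  edge_sign R l (flip k v) = edge_sign R l v * (-1) ^+ (k < l)%N.
Proof.
move=> vk; rewrite /edge_sign -exprD; congr (_ ^+ _).
rewrite (cardD1 k) inE /= ffunE eqxx orbT andbT addnC; congr (_ + _)%N.
apply: eq_card => j; rewrite !inE ffunE; case: eqVneq => [->|_] /=.
  by rewrite (negPf vk) andbF.
by rewrite orbF.
Qed.

(** Crossing the edge changes the relation between two arcs only when both lie on circles through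
    [k], and [f] has a single value there. *)
Lemma same_circle_toggle k v w (f : 'I_(narcs D) -> bool) a b : is_edge k v w ->
  (forall c d, same_circle v c d -> f c = f d) ->
  (forall c d, same_circle w c d -> f c = f d) ->
  same_circle v a b != same_circle w a b -> f a = f (arc k 0).
Proof.
move=> ed fv fw vw.
have uw := is_edge_neq ed; have wu j (jk : j != k) : w j = v j by rewrite uw.
have f02 : f (arc k 0) = f (arc k 2).
  have := toggle ed; case E: (same_circle v _ _) => /= H; first exact: fv.
  by apply: fw; rewrite H.
suff: touches v k a || touches w k a.
  by case/orP=> /orP[] => [/fv|/fv|/fw|/fw] ->.
have := toggle ed; case v02: (same_circle v (arc k 0) (arc k 2)) => /= w02.
  move: vw; rewrite (coarse_circle wu v02).
  by case: (same_circle w a b) => //=; case: (touches w k a); rewrite ?orbT.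
move: vw; rewrite (coarse_circle uw w02).
by case: (same_circle v a b) => //=; case: (touches v k a).
Qed.

(* [n1], [n2], [n3], [n4] count the circles at the four corners of a square and the booleans
   say which edges split a circle. *)
Lemma square_bool (S : comPzRingType) (a b c d : bool) (g g' : S) (n1 n2 n3 n4 : nat) :
  (n2 + ~~ a = n1 + a)%N -> (n4 + ~~ b = n2 + b)%N ->
  (n3 + ~~ c = n1 + c)%N -> (n4 + ~~ d = n3 + d)%N ->
  (c != b -> g' = g) -> (a != d -> g = g') ->
  (if a then g else 1) * (if b then g' else 1)
  = (if c then g' else 1) * (if d then g else 1).
Proof.
case: a; case: b; case: c; case: d => /= n12 n24 n13 n34 E1 E2;
  rewrite ?mulr1 ?mul1r //; first [by rewrite E1 | by rewrite E2 | exact: mulrC | by exfalso; lia].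
Qed.

Let edge_factor k v (g : R) := if same_circle v (arc k 0) (arc k 2) then g else 1.

Section Square.
Variables (x z : state D).
Hypothesis xz : lab x =1 lab z.

(** At [k] the intermediate resolution agrees with that of [z], and at every other crossing with
    that of [x]. *)
Lemma square_const k l c d : k != l -> res z = flip l (flip k (res x)) ->
  same_circle (flip k (res x)) c d -> lab z c = lab z d.
Proof.
move=> kl rz; apply: const_circle => {c d} j s; rewrite ffunE.
have [->|jk] := eqVneq j k.
  rewrite orbT; apply: lab_circle; have := joined_slot (res z) k s.
  by rewrite rz !ffunE eqxx !orbT.
by rewrite orbF -!xz; apply: lab_circle; apply: joined_slot.
Qed.

Lemma flipC k l v : flip l (flip k v) = flip k (flip l v).
Proof. by apply/ffunP => j; rewrite !ffunE orbAC. Qed.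

(** Both paths change the number of circles equally, so they split equally often. If a crossing
    merges on one path and splits on the other, both crossings carry the same label and the gaps
    agree. *)
Lemma square_factor k l : k != l -> ~~ res x k -> ~~ res x l ->
  res z = flip l (flip k (res x)) ->
  let gap j := root_gap val (lab z (arc j 0)) in
  edge_factor k (res x) (gap k) * edge_factor l (flip k (res x)) (gap l) =
  edge_factor l (res x) (gap l) * edge_factor k (flip l (res x)) (gap k).
Proof.
move=> kl xk xl rz gap.
have lk : l != k by rewrite eq_sym.
have rz' : res z = flip k (flip l (res x)) by rewrite -flipC.
have ek := is_edge_flip xk; have el := is_edge_flip xl.
have yl : ~~ flip k (res x) l by rewrite ffunE (negPf lk) orbF.
have yk : ~~ flip l (res x) k by rewrite ffunE (negPf kl) orbF.
have zc c d : same_circle (res x) c d -> lab z c = lab z d.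
  by rewrite -!xz; apply: lab_circle.
have H1 := same_circle_toggle ek zc (fun c d => square_const kl rz).
have H2 := same_circle_toggle el zc (fun c d => square_const lk rz').
rewrite /edge_factor.
apply: (square_bool (ncircles_edge ek) (ncircles_edge (is_edge_flip yl))
  (ncircles_edge el)); first by rewrite flipC; apply: ncircles_edge (is_edge_flip yk).
  by move/H1; rewrite /gap => ->.
by move/H2; rewrite /gap => ->.
Qed.

Let sq k l := \sum_y
  (if is_edge k (res x) (res y) then edge_sign R k (res x) * diag_coef val k x y else 0) *
  (if is_edge l (res y) (res z) then edge_sign R l (res y) * diag_coef val l y z else 0).

Let sqE k l : k != l -> ~~ res x k -> ~~ res x l -> res z = flip l (flip k (res x)) ->
  let gap j := root_gap val (lab z (arc j 0)) in
  sq k l = edge_sign R k (res x) * edge_sign R l (res x) * (-1) ^+ (k < l)%N *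
  (edge_factor k (res x) (gap k) * edge_factor l (flip k (res x)) (gap l)).
Proof.
move=> kl xk xl rz gap.
have yc c d := @square_const k l c d kl rz.
pose y := mkstate (flip k (res x)) (lab z).
have yz : lab y =1 lab z by move=> a; apply: lab_mkstate_const.
rewrite /sq (bigD1 y) //= big1 ?addr0 => [|y' y'y]; last first.
  case: ifP => [/andP[_ /eqP E]|_]; last by rewrite mul0r.
  rewrite {1}/diag_coef; case: forallP => [L|_]; last by rewrite mulr0 mul0r.
  case/eqP: y'y; apply: state_eq => // a.
  by rewrite yz -xz; apply/esym/eqP.
rewrite is_edge_flip // rz is_edge_flip; last by rewrite ffunE eq_sym (negPf kl) orbF.
rewrite edge_sign_flip // /diag_coef.
case: forallP => [_|[]]; last by move=> a; rewrite yz xz.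
case: forallP => [_|[]]; last by move=> a; rewrite yz.
by rewrite yz -/(edge_factor k _ _) -/(edge_factor l _ _) /gap; ring.
Qed.

Let sq_eq0 k l : ~~ [&& k != l, ~~ res x k, ~~ res x l & res z == flip l (flip k (res x))] ->
  sq k l = 0.
Proof.
move=> H; rewrite /sq big1 // => y _.
case: ifP => [/andP[xk /eqP E]|_]; last by rewrite mul0r.
case: ifP => [/andP[yl /eqP E']|_]; last by rewrite mulr0.
case/negP: H; rewrite xk; move: yl; rewrite E ffunE negb_or eq_sym => /andP[-> ->] /=.
by rewrite E' E; apply/eqP/ffunP => j; rewrite !ffunE.
Qed.

Let sq_anti k l : sq k l = - sq l k.
Proof.
have C : [&& l != k, ~~ res x l, ~~ res x k & res z == flip k (flip l (res x))] =
         [&& k != l, ~~ res x k, ~~ res x l & res z == flip l (flip k (res x))].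
  by rewrite eq_sym flipC; case: (k == l); case: (res x k); case: (res x l).
case H: [&& k != l, ~~ res x k, ~~ res x l & res z == flip l (flip k (res x))]; last first.
  by rewrite !sq_eq0 ?oppr0 ?C ?H.
case/and4P: H => kl xk xl /eqP rz.
have lk : l != k by rewrite eq_sym.
have rz' : res z = flip k (flip l (res x)) by rewrite -flipC.
rewrite (sqE kl xk xl rz) (sqE lk xl xk rz') (square_factor kl xk xl rz).
(* Exactly one of the two orders of [k] and [l] contributes the sign -1. *)
case: ltngtP => [||/val_inj/eqP] /=; last by rewrite (negPf kl).
  by move=> _; ring.
by move=> _; ring.
Qed.

Let sq_diag k : sq k k = 0.
Proof. by apply: sq_eq0; rewrite eqxx. Qed.

Lemma diag_dcoef_square : \sum_y diag_dcoef val x y * diag_dcoef val y z = 0.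
Proof.
transitivity (\sum_k \sum_l sq k l).
  rewrite /sq; under [RHS]eq_bigr do rewrite exchange_big.
  rewrite [RHS]exchange_big; apply: eq_bigr => y _.
  rewrite /diag_dcoef big_mkcond mulr_suml; apply: eq_bigr => k _.
  by rewrite [X in _ * X]big_mkcond mulr_sumr.
rewrite pair_big /= (bigID (fun p : 'I_(ncross D) * 'I_(ncross D) => p.1 < p.2)%N) /=.
rewrite [X in _ + X](bigID (fun p : 'I_(ncross D) * 'I_(ncross D) => p.1 == p.2)) /=.
rewrite [X in _ + (X + _)]big1 ?add0r => [|[k l] /andP[_ /eqP /= <-]]; last exact: sq_diag.
rewrite [X in _ + X](reindex_inj (h := fun p => (p.2, p.1))) /=; last first.
  by move=> [k l] [k' l'] [-> ->].
rewrite -[RHS](subrr (\sum_(p : 'I_(ncross D) * 'I_(ncross D) | (p.1 < p.2)%N) sq p.1 p.2)).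
rewrite -sumrN; congr (_ + _).
apply: eq_big => [[k l]|[k l] _] /=; last exact: sq_anti.
by rewrite -leqNgt ltn_neqAle andbC -val_eqE eq_sym.
Qed.
End Square.

Lemma diag_dcoef_lab x y : ~~ [forall a, lab x a == lab y a] -> diag_dcoef val x y = 0.
Proof. by move=> /negPf xy; rewrite /diag_dcoef big1 // => k _; rewrite /diag_coef xy mulr0. Qed.

Lemma diag_differential_square (c : chain R D) :
  diag_differential val (diag_differential val c) = 0.
Proof.
apply/ffunP => z; rewrite !ffunE.
under eq_bigr do rewrite ffunE mulr_suml.
rewrite exchange_big big1 // => x _.
under eq_bigr do rewrite -mulrA.
rewrite -mulr_sumr; have [/forallP xz|xz] := boolP [forall a, lab x a == lab z a].
  by rewrite diag_dcoef_square ?mulr0 // => a; apply/eqP.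
rewrite big1 ?mulr0 // => y _; have [/forallP xy|xy] := boolP [forall a, lab x a == lab y a].
  rewrite (@diag_dcoef_lab y) ?mulr0 //; apply: contra xz => /forallP yz.
  by apply/forallP => a; rewrite (eqP (xy a)).
by rewrite diag_dcoef_lab ?mul0r.
Qed.
End DiagSquare.

(** * Injectivity of the evaluation *)

Section Injectivity.
Variables (R : idomainType) (D : diagram) (val : bool -> R).
Implicit Types (x y z s : state D).

Lemma state_eqE x z : res x = res z ->
  [forall r, croots (res z) r ==> (lab x r == lab z r)] = (x == z).
Proof.
move=> xz; apply/forallP/eqP => [H|-> r]; last by rewrite eqxx implybT.
apply: state_eq => // a; rewrite -(lab_croot x) -(lab_croot z) xz.
by have := H (croot (res z) a); rewrite croots_root => /eqP.
Qed.

Lemma evaluate_eq0 (c : chain R D) : val true != val false -> evaluate val c = 0 -> c = 0.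
Proof.
move=> vtf c0; apply/ffunP => z; rewrite ffunE.
pose v := res z; pose gap := val true - val false.
(* The adjugate of the Vandermonde matrix of the two roots: it recovers the coefficients of a linear
   polynomial from its values, up to the factor [gap]. *)
pose K e e' : R := if e then (if e' then 1 else -1) else (if e' then - val false else val true).
have gap0 : gap != 0 by rewrite subr_eq0.
have KE e e' : \sum_d K e d * (if e' then val d else 1) = gap * (e' == e)%:R.
  by rewrite big_bool /K /gap; case: e; case: e'; rewrite /=; ring.
have : \sum_(s | res s == v) evaluate val c s * \prod_(r | croots v r) K (lab z r) (lab s r) = 0.
  by rewrite big1 // => s _; rewrite c0 ffunE mul0r.
under eq_bigr => s /eqP rs do rewrite ffunE rs mulr_suml.
rewrite exchange_big /=.
have S x : res x == v -> \sum_(s | res s == v) c x * monomial val v (lab x) (lab s)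
    * \prod_(r | croots v r) K (lab z r) (lab s r)
    = c x * (\prod_(r | croots v r) gap * (x == z)%:R).
  move=> /eqP rx; under [LHS]eq_bigr do rewrite -mulrA mulrC [monomial _ _ _ _ * _]mulrC -big_split.
  rewrite -mulr_suml mulrC; congr (_ * _).
  rewrite (state_sum v (fun r d => K (lab z r) d * (if lab x r then val d else 1))).
  under eq_bigr do rewrite KE.
  rewrite big_split; congr (_ * _); rewrite -state_eqE //.
  case: forallP => [H|/forallP].
    by rewrite big1 // => r rr; move: (H r); rewrite rr /= => ->.
  rewrite negb_forall => /existsP[r]; rewrite negb_imply => /andP[rr /negPf xr].
  by rewrite (bigD1 r) //= xr mul0r.
rewrite (eq_bigr _ S) (bigD1 z) //= eqxx mulr1 [X in _ + X]big1 ?addr0; last first.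
  by move=> x /andP[_ /negPf ->]; rewrite !mulr0.
move/eqP; rewrite mulf_eq0 => /orP[/eqP //|].
by rewrite prodf_seq_eq0 => /hasP[r _ /andP[_ /eqP E]]; rewrite E eqxx in gap0.
Qed.
End Injectivity.

(** * From Lee to reduced Bar-Natan *)

(** The substitution of X + m for X on every circle; [K x y] is the coefficient of [y] in the
    expansion of [x]. *)
Lemma evaluate_shift (R : comNzRingType) (D : diagram) (val val' : bool -> R) (m : R)
    (c : chain R D) : (forall e, val' e = val e + m) ->
  exists c', evaluate val c' = evaluate val' c.
Proof.
move=> vE; pose K (x y : state D) := \prod_(r | croots (res x) r)
  (if lab x r then (if lab y r then 1 else m) else (~~ lab y r)%:R).
exists [ffun y => \sum_(x | res x == res y) c x * K x y].
apply/ffunP => s; rewrite !ffunE.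
under eq_bigr => y /eqP ry do rewrite ffunE ry mulr_suml.
rewrite exchange_big /=; apply: eq_bigr => x /eqP rx.
under [LHS]eq_bigr do rewrite -mulrA.
rewrite -mulr_sumr; congr (_ * _); rewrite /K rx /monomial.
under [LHS]eq_bigr do rewrite -big_split.
rewrite (state_sum (res s) (fun r e => (if lab x r then (if e then 1 else m) else (~~ e)%:R)
  * (if e then val (lab s r) else 1))).
apply: eq_bigr => r _; rewrite big_bool vE.
by case: (lab x r); rewrite /= ?mul1r ?mulr1 // mul0r add0r.
Qed.

Section BaseChange.
Variables (R S : comNzRingType) (phi : {rmorphism R -> S}) (D : diagram) (h t : R).
Implicit Types (x y : state D).

Definition chain_map (c : chain R D) : chain S D := [ffun x => phi (c x)].

Lemma map_qmul a b c : phi (qmul h t a b c) = qmul (phi h) (phi t) a b c.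
Proof. by rewrite /qmul; case: (a && b) => //; [case: c | rewrite rmorph_nat]. Qed.

Lemma map_qcomul a b c : phi (qcomul h t a b c) = qcomul (phi h) (phi t) a b c.
Proof. by case: a; case: b; case: c; rewrite /= ?rmorphN ?rmorph0 ?rmorph1. Qed.

Lemma map_dcoef x y : phi (dcoef (quadratic_frobenius h t) x y)
  = dcoef (quadratic_frobenius (phi h) (phi t)) x y.
Proof.
rewrite /dcoef rmorph_sum; apply: eq_bigr => k _.
rewrite rmorphM /edge_sign rmorphXn rmorphN1; congr (_ * _).
rewrite /edge_coef; case: ifP => _; last exact: rmorph0.
by case: ifP => _; case: ifP => _; rewrite ?rmorph0 // ?[LHS]map_qmul ?[LHS]map_qcomul.
Qed.

Lemma map_Xcoef p x y : phi (Xcoef (quadratic_frobenius h t) p x y)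
  = Xcoef (quadratic_frobenius (phi h) (phi t)) p x y.
Proof. by rewrite /Xcoef; case: ifP => _; rewrite ?rmorph0 // [LHS]map_qmul. Qed.

Lemma map_differential c :
  chain_map (differential (quadratic_frobenius h t) c)
  = differential (quadratic_frobenius (phi h) (phi t)) (chain_map c).
Proof.
apply/ffunP => y; rewrite !ffunE rmorph_sum; apply: eq_bigr => x _.
by rewrite rmorphM map_dcoef ffunE.
Qed.

Lemma map_Xact p c :
  chain_map (Xact (quadratic_frobenius h t) p c)
  = Xact (quadratic_frobenius (phi h) (phi t)) p (chain_map c).
Proof.
apply/ffunP => y; rewrite !ffunE rmorph_sum; apply: eq_bigr => x _.
by rewrite rmorphM map_Xcoef ffunE.
Qed.
End BaseChange.

Section Linear.
Variables (R : comNzRingType) (D : diagram).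
Implicit Types (c : chain R D).

Lemma evaluateZD val (r : R) c c' s :
  evaluate val [ffun x => r * c x + c' x] s = r * evaluate val c s + evaluate val c' s.
Proof.
rewrite !ffunE mulr_sumr -big_split; apply: eq_bigr => x _.
by rewrite ffunE mulrDl mulrA.
Qed.

Lemma differentialZ A (r : R) c :
  differential A [ffun x => r * c x] = [ffun y => r * differential A c y].
Proof.
apply/ffunP => y; rewrite !ffunE mulr_sumr; apply: eq_bigr => x _.
by rewrite ffunE mulrA.
Qed.

Lemma evaluateB val c c' s : evaluate val (c - c') s = evaluate val c s - evaluate val c' s.
Proof.
rewrite !ffunE -sumrB; apply: eq_bigr => x _.
by rewrite !ffunE mulrBl.
Qed.
End Linear.

(** * The correspondence between Lee chains and reduced Bar-Natan chains *)

Section LeeBarNatan.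
Variables (F : fieldType) (D : diagram) (p : 'I_(narcs D)).
Hypothesis char2 : 2%N \notin [pchar F].
Hypothesis toggle : forall k (v w : vertex D), is_edge k v w ->
  same_circle w (arc k 0) (arc k 2) = ~~ same_circle v (arc k 0) (arc k 2).

Let two_neq0 : (2%:R : F) != 0.
Proof. by move: char2; rewrite inE /=. Qed.

(* The variable X of the Lee complex becomes ['X / 2] in terms of the variable H of
   the Bar-Natan complex. *)
Definition halfX : {poly F} := 2^-1 *: 'X.
Definition lee_root (e : bool) : {poly F} := if e then halfX else - halfX.
Definition bn_root (e : bool) : {poly F} := if e then 'X else 0.

Lemma halfXD : halfX + halfX = 'X.
Proof.
by rewrite /halfX -scalerDl -[2^-1]mulr1 -mulrDr -mulr2n mulVf // scale1r.
Qed.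

(** The roots H / 2, - H / 2 and H, 0 differ by a translation, so both complexes have the same
    diagonal differential. *)
Lemma root_gap_eq e : root_gap lee_root e = root_gap bn_root e.
Proof.
case: e; rewrite /root_gap /= ?opprK ?subr0 ?sub0r ?halfXD //.
by rewrite -opprD halfXD.
Qed.

Definition half_square : {rmorphism {poly F} -> {poly F}} := comp_poly (halfX ^+ 2).

Definition lee_eval (c : Lee_chain F D) := evaluate lee_root (chain_map half_square c).
Definition bn_eval (b : chain {poly F} D) := evaluate bn_root b.

Lemma bn_eval_differential b :
  bn_eval (differential (BarNatan F) b) = diag_differential bn_root (bn_eval b).
Proof.
rewrite /bn_eval -(evaluate_differential _ toggle) /bn_root /BarNatan.
by rewrite addr0 mulr0 oppr0.
Qed.

Lemma bn_eval_Xact b s : bn_eval (Xact (BarNatan F) p b) s = bn_root (lab s p) * bn_eval b s.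
Proof.
by rewrite /bn_eval -evaluate_Xact /bn_root /BarNatan addr0 mulr0 oppr0.
Qed.

Let lee_frobenius : quadratic_frobenius (half_square 0) (half_square 'X)
  = quadratic_frobenius (lee_root true + lee_root false) (- (lee_root true * lee_root false)).
Proof.
congr quadratic_frobenius; first by rewrite rmorph0 /= subrr.
by rewrite /= comp_polyX mulrN opprK expr2.
Qed.

Lemma lee_eval_differential c :
  lee_eval (differential (Lee F) c) = diag_differential lee_root (lee_eval c).
Proof. by rewrite /lee_eval map_differential lee_frobenius evaluate_differential. Qed.

Lemma lee_eval_Xact c s : lee_eval (Xact (Lee F) p c) s = lee_root (lab s p) * lee_eval c s.
Proof. by rewrite /lee_eval map_Xact lee_frobenius evaluate_Xact. Qed.

Lemma bn_eval_eq0 b : bn_eval b = 0 -> b = 0.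
Proof. by apply: evaluate_eq0; rewrite /= polyX_eq0. Qed.

Lemma BarNatan_square (b : chain {poly F} D) :
  differential (BarNatan F) (differential (BarNatan F) b) = 0.
Proof. by apply: bn_eval_eq0; rewrite !bn_eval_differential diag_differential_square. Qed.

Lemma halfX_neq0 : halfX != 0.
Proof. by rewrite /halfX scaler_eq0 invr_eq0 (negPf two_neq0) polyX_eq0. Qed.

Lemma lee_root_neq : lee_root true != lee_root false.
Proof. by rewrite -subr_eq0 /= opprK halfXD polyX_eq0. Qed.

(** F[H] is generated over F[T] by 1 and H / 2: take even and odd parts. The factors 4 and 2 undo T
    = H^2 / 4 and the 1 / 2 in [halfX]. *)
Lemma half_square_split (f : {poly F}) :
  exists g0 g1, f = half_square g0 + halfX * half_square g1.
Proof.
exists (even_poly f \Po (4%:R *: 'X)), (2%:R *: (odd_poly f \Po (4%:R *: 'X))).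
have E g : half_square (g \Po (4%:R *: 'X)) = g \Po 'X^2.
  rewrite /= -comp_polyA; congr (_ \Po _); rewrite comp_polyZ comp_polyX /halfX exprZn scalerA.
  rewrite -[4%:R](_ : 2%:R ^+ 2 = _) -?exprMn ?divff ?mulfV ?expr1n ?scale1r //.
  by rewrite -natrX.
rewrite E [half_square _]linearZ E -scalerAr /halfX -scalerAl scalerA mulfV // scale1r mulrC.
by rewrite poly_even_odd.
Qed.

(** The substitution of - H for H fixes the first summand and negates the second, so twice the first
    one is zero. *)
Lemma half_square_indep (g0 g1 : {poly F}) :
  half_square g0 + halfX * half_square g1 = 0 -> g0 = 0 /\ g1 = 0.
Proof.
have half_eq0 g : half_square g = 0 -> g = 0.
  move/eqP; rewrite /= comp_poly_eq0 => [/eqP //|].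
  by rewrite /halfX exprZn size_scale ?size_polyXn // expf_neq0 // invr_eq0.
pose sigma : {rmorphism {poly F} -> {poly F}} := comp_poly (- 'X).
have sX : sigma halfX = - halfX by rewrite /sigma /= /halfX comp_polyZ comp_polyX scalerN.
have sh g : sigma (half_square g) = half_square g.
  rewrite /sigma /= -comp_polyA; congr (_ \Po _).
  by rewrite [LHS]rmorphXn /= -/sigma sX sqrrN.
move=> E; have: sigma (half_square g0 + halfX * half_square g1) = 0 by rewrite E rmorph0.
rewrite rmorphD rmorphM sX !sh mulNr => E'.
have E0 : half_square g0 = 0.
  have: half_square g0 + half_square g0 = 0.
    by rewrite -[RHS](addr0 0) -{1}E -E' addrACA subrr addr0.
  rewrite -mulr2n -mulr_natl => /eqP; rewrite mulf_eq0 -polyC_natr polyC_eq0.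
  by rewrite (negPf two_neq0) => /eqP.
split; apply: half_eq0 => //; move/eqP: E; rewrite E0 add0r mulf_eq0.
by rewrite (negPf halfX_neq0) => /eqP.
Qed.

(* [b] is the image of [c] under the isomorphism from the Lee complex to the reduced
   Bar-Natan complex given by multiplication by X + H / 2 at the base point. *)
Definition related (c : Lee_chain F D) (b : chain {poly F} D) : Prop :=
  forall s, bn_eval b s = if lab s p then 'X * lee_eval c s else 0.

Definition reduced (b : chain {poly F} D) : Prop := forall x, ~~ lab x p -> b x = 0.

(** The diagonal differential preserves the label at the base point, so the case distinction in
    [related] passes through it. *)
Lemma related_differential c b : related c b ->
  related (differential (Lee F) c) (differential (BarNatan F) b).
Proof.
move=> cb z; rewrite bn_eval_differential lee_eval_differential !ffunE.
have gapE y : diag_dcoef lee_root y z = diag_dcoef bn_root y z.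
  by apply: eq_bigr => k _; rewrite /diag_coef root_gap_eq.
have E y : bn_eval b y * diag_dcoef bn_root y z =
    (if lab z p then 'X * lee_eval c y else 0) * diag_dcoef bn_root y z.
  have [/forallP yz|yz] := boolP [forall a, lab y a == lab z a].
    by rewrite cb (eqP (yz p)).
  by rewrite diag_dcoef_lab ?mulr0.
under eq_bigr do rewrite E.
case: (lab z p); last by rewrite big1 // => y _; rewrite mul0r.
by rewrite mulr_sumr; apply: eq_bigr => y _; rewrite mulrA gapE.
Qed.

(** Only points with root H / 2 at the base point count in [related], and there X acts as the scalar
    H / 2. *)
Lemma related_Xact n c b : related c b ->
  related (iter n (Xact (Lee F) p) c) [ffun x => halfX ^+ n * b x].
Proof.
move=> cb; elim: n => [|n IH] s.
  rewrite /= -cb; congr (bn_eval _ s); apply/ffunP => x.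
  by rewrite ffunE expr0 mul1r.
have scale m : bn_eval [ffun x => halfX ^+ m * b x] s = halfX ^+ m * bn_eval b s.
  rewrite /bn_eval -[RHS]addr0 -(_ : evaluate bn_root (0 : chain {poly F} D) s = 0).
    by rewrite -evaluateZD; congr (evaluate _ _ s); apply/ffunP => x; rewrite !ffunE addr0.
  by rewrite ffunE big1 // => x _; rewrite ffunE mul0r.
rewrite iterS lee_eval_Xact scale exprS -mulrA -scale IH.
by case: (lab s p); rewrite ?mulr0 //= mulrCA.
Qed.

Lemma related_inj_r c b b' : related c b -> related c b' -> b = b'.
Proof.
move=> cb cb'; apply/eqP; rewrite -subr_eq0; apply/eqP/bn_eval_eq0/ffunP => s.
by rewrite evaluateB -/(bn_eval b) -/(bn_eval b') cb cb' subrr ffunE.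
Qed.

Lemma lee_evalB c c' s : lee_eval (c - c') s = lee_eval c s - lee_eval c' s.
Proof.
rewrite -evaluateB; congr (evaluate _ _ s); apply/ffunP => x.
by rewrite !ffunE rmorphB.
Qed.

(** (H / 2 + X) c vanishes at every point, its first factor being zero where the base label is
    [false]. Its coefficients are then zero, and 1, H / 2 are independent over F[T]. *)
Lemma lee_eval_inj c : (forall s, lab s p -> lee_eval c s = 0) -> c = 0.
Proof.
move=> H; pose c2 : chain {poly F} D :=
  [ffun x => halfX * chain_map half_square c x + chain_map half_square (Xact (Lee F) p c) x].
have /ffunP c20 : c2 = 0.
  apply: (evaluate_eq0 lee_root_neq); apply/ffunP => s.
  rewrite evaluateZD -/(lee_eval c) -/(lee_eval (Xact _ _ _)) lee_eval_Xact -mulrDl [RHS]ffunE.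
  by case E: (lab s p); [rewrite H ?mulr0 | rewrite /= subrr mul0r].
apply/ffunP => x; have := c20 x; rewrite !ffunE addrC.
by case/half_square_indep.
Qed.

Lemma related_inj_l c c' b : related c b -> related c' b -> c = c'.
Proof.
move=> cb cb'; apply/eqP; rewrite -subr_eq0; apply/eqP/lee_eval_inj => s ps.
have X0 : 'X != 0 :> {poly F} by rewrite polyX_eq0.
by have := cb s; rewrite cb' ps => /(mulfI X0) E; rewrite lee_evalB E subrr.
Qed.

Let bn_shift e : lee_root e = bn_root e + - halfX.
Proof. by case: e; rewrite /= ?sub0r // -halfXD addrK. Qed.

(** [c'] has coefficients in F[H] and may not come from the Lee complex; multiplication by X on the
    Bar-Natan side discards its values at base label [false]. *)
Lemma related_Xact_lee c c' b : evaluate bn_root b = evaluate lee_root c' ->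
  (forall s, lab s p -> lee_eval c s = evaluate lee_root c' s) ->
  related c (Xact (BarNatan F) p b).
Proof.
move=> bc H s; rewrite bn_eval_Xact /bn_eval bc.
by case E: (lab s p); rewrite /= ?mul0r ?H.
Qed.

Lemma related_exists_r c : exists2 b, reduced b & related c b.
Proof.
have [b bc] := evaluate_shift (chain_map half_square c) bn_shift.
exists (Xact (BarNatan F) p b); first by apply/reducedP; exists b.
exact: related_Xact_lee bc _.
Qed.

(** Where the base label is [true], H / 2 acts as X. Replacing H / 2 by X in the odd part of each
    coefficient leaves coefficients in F[T]. *)
Lemma related_exists_l b : reduced b -> exists c, related c b.
Proof.
case/reducedP=> b' ->.
have [|c' c'b] := @evaluate_shift _ _ lee_root bn_root halfX b'.
  by move=> e; rewrite bn_shift subrK.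
have spl x := half_square_split (c' x).
have [g0 g0P] := fin_all_exists spl; have [g1 g1P] := fin_all_exists g0P.
exists (finfun g0 + Xact (Lee F) p (finfun g1)).
apply: (related_Xact_lee (esym c'b)) => s ps.
transitivity (lee_eval (finfun g0) s + halfX * lee_eval (finfun g1) s).
  have <- : lee_eval (Xact (Lee F) p (finfun g1)) s = halfX * lee_eval (finfun g1) s.
    by rewrite lee_eval_Xact ps.
  rewrite addrC -[X in _ = X + _]mul1r /lee_eval -evaluateZD.
  congr (evaluate _ _ s); apply/ffunP => x.
  by rewrite !ffunE mul1r rmorphD addrC.
rewrite addrC /lee_eval -evaluateZD; congr (evaluate _ _ s); apply/ffunP => x.
by rewrite g1P !ffunE addrC.
Qed.

Definition H_kills_torsion (n : nat) : Prop := forall b, reduced b ->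
  differential (BarNatan F) b = 0 ->
  (exists m, exists2 a, reduced a & [ffun x => 'X ^+ m * b x] = differential (BarNatan F) a) ->
  exists2 a, reduced a & [ffun x => 'X ^+ n * b x] = differential (BarNatan F) a.

Lemma XnE n : 'X ^+ n = (2%:R ^+ n)%:P * halfX ^+ n :> {poly F}.
Proof. by rewrite /halfX exprZn mul_polyC scalerA -exprMn mulfV // expr1n scale1r. Qed.

Lemma H_halfX_boundary n (b : chain {poly F} D) :
  (exists2 a, reduced a & [ffun x => 'X ^+ n * b x] = differential (BarNatan F) a) <->
  (exists2 a, reduced a & [ffun x => halfX ^+ n * b x] = differential (BarNatan F) a).
Proof.
split=> -[a ra E].
  exists [ffun x => (2%:R ^- n)%:P * a x]; first by move=> x xp; rewrite ffunE ra ?mulr0.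
  rewrite differentialZ -E; apply/ffunP => x; rewrite !ffunE XnE !mulrA -polyCM mulVf ?mul1r //.
  by rewrite expf_neq0.
exists [ffun x => (2%:R ^+ n)%:P * a x]; first by move=> x xp; rewrite ffunE ra ?mulr0.
by rewrite differentialZ -E; apply/ffunP => x; rewrite !ffunE XnE mulrA.
Qed.

Lemma related_boundary n c b : related c b -> reduced b ->
  Xpow_kills p n c <->
  (exists2 a, reduced a & [ffun x => 'X ^+ n * b x] = differential (BarNatan F) a).
Proof.
move=> cb rb; rewrite H_halfX_boundary; have nb := related_Xact n cb; split.
  case=> c' E; have [a ra c'a] := related_exists_r c'; exists a => //.
  apply: (related_inj_r nb); rewrite E; exact: related_differential.
case=> a ra E; have [c' c'a] := related_exists_l ra; exists c'.
apply: (related_inj_l nb); rewrite E; exact: related_differential.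
Qed.

Lemma related_cycle c b : related c b ->
  Lee_cycle c <-> differential (BarNatan F) b = 0.
Proof.
move=> cb; have db := related_differential cb.
have z0 : related 0 0.
  move=> s; rewrite [LHS]ffunE big1 => [|x _]; last by rewrite ffunE mul0r.
  case: (lab s p) => //; rewrite [lee_eval _ _]ffunE big1 ?mulr0 // => x _.
  by rewrite !ffunE rmorph0 mul0r.
split=> E; rewrite /Lee_cycle E in db *; [exact: related_inj_r z0 | exact: related_inj_l db z0].
Qed.

Lemma Xpow_kills_torsionE n : Xpow_kills_torsion F p n <-> H_kills_torsion n.
Proof.
split=> T.
  move=> b rb db [m mb]; have [c cb] := related_exists_l rb.
  apply/(related_boundary n cb rb); apply: T; first exact/(related_cycle cb).
  by exists m; apply/(related_boundary m cb rb).
move=> c dc [m mc]; have [b rb cb] := related_exists_r c.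
apply/(related_boundary n cb rb); apply: T => //; first exact/(related_cycle cb).
by exists m; apply/(related_boundary m cb rb).
Qed.
End LeeBarNatan.

(** * Homogeneity *)

Lemma nXcirclesE (D : diagram) (x : state D) :
  nXcircles x = (\sum_(r | croots (res x) r) lab x r)%N.
Proof.
rewrite /nXcircles /n_comp_mem -sum1_card.
rewrite (eq_bigl (fun r => croots (res x) r && lab x r)) => [|r]; last by rewrite !inE.
by rewrite big_mkcondr; apply: eq_bigr => r _; case: (lab x r).
Qed.

#[local] Opaque same_circle croot croots lab ncircles nXcircles.

Section Degrees.
Variables (F : fieldType) (D : diagram).
Hypothesis toggle : forall k (v w : vertex D), is_edge k v w ->
  same_circle w (arc k 0) (arc k 2) = ~~ same_circle v (arc k 0) (arc k 2).
Implicit Types (x y : state D) (k : 'I_(ncross D)).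

Lemma weight_edge k (v w : vertex D) : is_edge k v w -> weight w = (weight v).+1.
Proof.
case/andP=> vk /eqP->; rewrite /weight (cardD1 k) inE /= ffunE eqxx orbT add1n.
congr _.+1; apply: eq_card => j; rewrite !inE ffunE; case: eqVneq => [->|_] /=.
  by rewrite (negPf vk).
by rewrite orbF.
Qed.

Lemma hdeg_edge k x y : is_edge k (res x) (res y) -> hdeg y = hdeg x + 1.
Proof. by move=> ed; rewrite /hdeg (weight_edge ed) -addn1 PoszD addrAC. Qed.

Lemma nX_merge k x y : is_edge k (res x) (res y) ->
  ~~ same_circle (res x) (arc k 0) (arc k 2) -> agree_away k x y ->
  let A0 := arc k 0 in let A2 := arc k 2 in
  (nXcircles y + lab x A0 + lab x A2
   = nXcircles x + lab y A0)%N.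
Proof.
move=> ed x02 /forallP ag A0 A2; rewrite {}/A0 {}/A2; have uw := is_edge_neq ed.
have y02 : same_circle (res y) (arc k 0) (arc k 2) by rewrite (toggle ed).
rewrite !nXcirclesE (big_fine uw y02 x02) (big_coarse uw y02) /= !lab_croot.
have <- : (\sum_(r | croots (res y) r && ~~ touches (res x) k r) lab x r
  = \sum_(r | croots (res y) r && ~~ touches (res x) k r) lab y r)%N; last first.
  by move: (\sum_(r | _) _)%N => O; lia.
apply: eq_bigr => r /andP[_ /negPf tr].
by have := ag r; rewrite tr /= => /eqP ->.
Qed.

Lemma nX_split k x y : is_edge k (res x) (res y) ->
  same_circle (res x) (arc k 0) (arc k 2) -> agree_away k x y ->
  let A0 := arc k 0 in let A2 := arc k 2 in
  (nXcircles y + lab x A0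
   = nXcircles x + lab y A0 + lab y A2)%N.
Proof.
move=> ed x02 /forallP ag A0 A2; rewrite {}/A0 {}/A2.
have uw j (jk : j != k) : (res y) j = (res x) j by rewrite (is_edge_neq ed).
have y02 : ~~ same_circle (res y) (arc k 0) (arc k 2) by rewrite (toggle ed) x02.
have tE a : touches (res x) k a = touches (res y) k a.
  rewrite -(coarse_touches uw x02) {1}/touches; have := same_circleW a x02.
  by rewrite ![same_circle _ _ a]same_circle_sym => <-; rewrite orbb.
rewrite !nXcirclesE (big_fine uw x02 y02) (big_coarse uw x02) /= !lab_croot.
have <- : (\sum_(r | croots (res x) r && ~~ touches (res y) k r) lab x r
  = \sum_(r | croots (res x) r && ~~ touches (res y) k r) lab y r)%N; last first.
  by move: (\sum_(r | _) _)%N => O; lia.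
apply: eq_bigr => r /andP[_ /negPf tr].
by have := ag r; rewrite tE tr /= => /eqP ->.
Qed.

(** [f] is a scalar times H^(n / 2), and 0 if n is odd or negative. The scalar is given as the value
    at H = 1 because that is the entry of the filtered complex. *)
Let homogeneous (n : int) (f : {poly F}) := forall e,
  f`_e = if n == 2 * e%:Z then f.[1] else 0.

Let homogeneous0 n : homogeneous n 0.
Proof. by move=> e; rewrite coef0 horner0 if_same. Qed.

Let homogeneousZ n c f : homogeneous n f -> homogeneous n (c%:P * f).
Proof.
by move=> hf e; rewrite coefCM hf hornerM hornerC; case: ifP; rewrite ?mulr0.
Qed.

Let homogeneousX n (d : nat) : n = 2 * d%:Z -> homogeneous n 'X^d.
Proof.
move=> -> e; rewrite coefXn hornerXn expr1n.
by have -> : (2 * d%:Z == 2 * e%:Z) = (e == d); [apply/eqP/eqP => H; lia | case: eqP].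
Qed.

Let homogeneous1 n : n = 0 -> homogeneous n 1.
Proof. by move=> n0; rewrite -(expr0 'X); apply: homogeneousX; rewrite n0. Qed.

Let homogeneous_H n : n = 2 -> homogeneous n 'X.
Proof. by move=> n0; rewrite -['X]expr1; apply: homogeneousX; rewrite n0. Qed.

Lemma edge_coef_homogeneous k x y : is_edge k (res x) (res y) ->
  homogeneous (qdeg y - qdeg x) (edge_coef (BarNatan F) k x y).
Proof.
move=> ed; have nc := ncircles_edge toggle ed; have we := weight_edge ed.
case: (boolP (same_circle (res x) (arc k 0) (arc k 2))) => x02; rewrite ?x02 ?(negPf x02) /= in nc.
  rewrite edge_coef_split // ?(toggle ed) ?x02 //.
  case: (boolP (agree_away k x y)) => ag; last by rewrite mul0r.
  rewrite mul1r; have := nX_split ed x02 ag.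
  have -> : qdeg y - qdeg x = 2 * ((nXcircles x)%:Z - (nXcircles y)%:Z + 1).
    by rewrite /qdeg; lia.
  move: (nXcircles x) (nXcircles y) => m n; rewrite /= /qcomul.
  case: (lab x _); case: (lab y _); case: (lab y _) => /= mn;
    rewrite -?polyCN //; try exact: homogeneous0; try (by apply: homogeneous1; lia).
  by rewrite -[- 'X]mulN1r -polyCN; apply: homogeneousZ; apply: homogeneous_H; lia.
rewrite edge_coef_merge // ?(toggle ed) //.
case: (boolP (agree_away k x y)) => ag; last by rewrite mul0r.
rewrite mul1r; have := nX_merge ed x02 ag.
have -> : qdeg y - qdeg x = 2 * ((nXcircles x)%:Z - (nXcircles y)%:Z).
  by rewrite /qdeg; lia.
move: (nXcircles x) (nXcircles y) => m n; rewrite /= /qmul.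
case: (lab x _); case: (lab x _); case: (lab y _) => /= mn;
  try exact: homogeneous0; try (by apply: homogeneous1; lia).
by apply: homogeneous_H; lia.
Qed.

Lemma dcoef_homogeneous x y e : (dcoef (BarNatan F) x y)`_e =
  if qdeg y - qdeg x == 2 * e%:Z then (dcoef (BarNatan F) x y).[1] else 0.
Proof.
rewrite /dcoef coef_sum horner_sum.
transitivity (\sum_(k | is_edge k (res x) (res y)) (if qdeg y - qdeg x == 2 * e%:Z then
   (edge_sign {poly F} k (res x) * edge_coef (BarNatan F) k x y).[1] else 0)); last first.
  by case: ifP => _ //; rewrite big1.
apply: eq_bigr => k ed.
have -> : edge_sign {poly F} k (res x) = (edge_sign F k (res x))%:P.
  by rewrite /edge_sign rmorphXn rmorphN1.
exact: homogeneousZ (edge_coef_homogeneous ed) e.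
Qed.

Lemma dcoef_hdeg (R : comNzRingType) (A : frobenius R) x y :
  hdeg y != hdeg x + 1 -> dcoef A x y = 0.
Proof.
by move=> h; rewrite /dcoef big1 // => k /hdeg_edge E; rewrite E eqxx in h.
Qed.
End Degrees.

(** * Torsion and pages *)

Section GradedMatrix.
Import Order.TTheory Num.Theory.

Variables (F : fieldType) (T : finType) (M : T -> T -> {poly F}).

Definition poly_diff (c : {ffun T -> {poly F}}) : {ffun T -> {poly F}} :=
  [ffun y => \sum_x c x * M x y].
Definition unit_diff (c : {ffun T -> F^o}) : {ffun T -> F^o} :=
  [ffun y => \sum_x c x * (M x y).[1]].
Definition scaled (n : nat) (c : {ffun T -> {poly F}}) : {ffun T -> {poly F}} :=
  [ffun x => 'X^n * c x].

Definition torsion_killed (n : nat) : Prop := forall b, poly_diff b = 0 ->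
  (exists m, exists a, scaled m b = poly_diff a) -> exists a, scaled n b = poly_diff a.

Hypothesis M_square : forall x z, \sum_y M x y * M y z = 0.

Lemma unit_diff_square c : unit_diff (unit_diff c) = 0.
Proof.
apply/ffunP => z; rewrite !ffunE.
under eq_bigr do rewrite ffunE mulr_suml.
rewrite exchange_big big1 // => x _.
under eq_bigr do rewrite -mulrA.
rewrite -mulr_sumr -[X in _ * X](_ : (\sum_y M x y * M y z).[1] = _); last first.
  by rewrite horner_sum; apply: eq_bigr => y _; rewrite hornerM.
by rewrite M_square horner0 mulr0.
Qed.

Lemma unit_diff0 : unit_diff 0 = 0.
Proof. by apply/ffunP => y; rewrite !ffunE big1 // => x _; rewrite ffunE mul0r. Qed.

Section Level.
(* [x] is a generator in degree [Q x], the variable having degree -1. *)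
Variable Q : T -> int.
Hypothesis M_homogeneous : forall x y e,
  (M x y)`_e = if Q y - Q x == e%:Z then (M x y).[1] else 0.

Definition above (K : int) (c : {ffun T -> F^o}) : Prop := forall x, Q x < K -> c x = 0.

Lemma M_monomial x y :
  M x y = if (0 : int) <= Q y - Q x then (M x y).[1] *: 'X^(`|Q y - Q x|) else 0.
Proof.
apply/polyP => e; rewrite M_homogeneous; case: ifP => [/eqP ->|ne].
  by rewrite /= coefZ coefXn /= eqxx mulr1.
case: ifP => [ge|]; rewrite ?coef0 // coefZ coefXn.
by case: eqP => [E|_]; [move: ne; rewrite E; lia | rewrite mulr0].
Qed.

(** Homogenization in degree [K], with inverse [slice]: the degree [K] part at H = 1. The absolute
    value is the right exponent only on chains [above] [K]. *)
Definition lift (K : int) (c : {ffun T -> F^o}) : {ffun T -> {poly F}} :=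
  [ffun x => (c x : F) *: 'X^(`|Q x - K|)].
Definition slice (K : int) (c : {ffun T -> {poly F}}) : {ffun T -> F^o} :=
  [ffun x => if K <= Q x then (c x)`_(`|Q x - K|) else 0].

Lemma slice_above K c : above K (slice K c).
Proof. by move=> x; rewrite ffunE ltNge => /negPf ->. Qed.

Lemma scaled_lift n K c : above K c -> scaled n (lift K c) = lift (K - n%:Z) c.
Proof.
move=> cK; apply/ffunP => x; rewrite !ffunE.
have [xK|xK] := ltP (Q x) K; first by rewrite cK // !scale0r mulr0.
by rewrite -scalerAr -exprD; congr (_ *: 'X^_); lia.
Qed.

Lemma poly_diff_lift K c : above K c -> poly_diff (lift K c) = lift K (unit_diff c).
Proof.
move=> cK; apply/ffunP => y; rewrite !ffunE scaler_suml; apply: eq_bigr => x _.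
rewrite ffunE.
have [xK|xK] := ltP (Q x) K; first by rewrite cK // !(scale0r, mul0r).
rewrite [in LHS]M_monomial [in RHS]M_monomial; case: ifP => [xy|_]; last first.
  by rewrite horner0 !mulr0 scale0r.
rewrite hornerZ hornerXn expr1n mulr1 -scalerAl -scalerAr scalerA -exprD.
by congr (_ *: 'X^_); lia.
Qed.

Lemma slice_diff K c : slice K (poly_diff c) = unit_diff (slice K c).
Proof.
apply/ffunP => y; rewrite !ffunE; case: ifP => yK.
  rewrite coef_sum; apply: eq_bigr => x _; rewrite ffunE M_monomial.
  case: ifP => xy; last by rewrite mulr0 coef0 horner0 mulr0.
  rewrite hornerZ hornerXn expr1n mulr1 -scalerAr coefZ coefMXn mulrC; congr (_ * _).
  case: ifP => [lt|ge]; first by rewrite ifF //; lia.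
  by rewrite ifT; [congr (_)`_(_) | ]; lia.
rewrite big1 // => x _; rewrite ffunE M_monomial.
case: ifP => [xK|_]; last by rewrite mul0r.
by rewrite ifF ?horner0 ?mulr0 //; lia.
Qed.

Lemma slice_lift K c : above K c -> slice K (lift K c) = c.
Proof.
move=> cK; apply/ffunP => x; rewrite !ffunE.
case: ltP => xK; first by rewrite cK.
by rewrite coefZ coefXn eqxx mulr1.
Qed.

Lemma slice_scaled n K c : slice K (scaled n c) = slice (K + n%:Z) c.
Proof.
apply/ffunP => x; rewrite !ffunE mulrC coefMXn.
case: ifP => xK; last by rewrite ifF //; lia.
case: ifP => [lt|ge]; first by rewrite ifF //; lia.
by rewrite ifT; [congr (_)`_(_) | ]; lia.
Qed.

Lemma slice_inj c c' : (forall K, slice K c = slice K c') -> c = c'.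
Proof.
move=> E; apply/ffunP => x; apply/polyP => e.
have /ffunP/(_ x) := E (Q x - e%:Z); have le : Q x - e%:Z <= Q x by lia.
have E1 : `|Q x - (Q x - e%:Z)%R|%N = e by lia.
by rewrite !ffunE le E1.
Qed.

Definition boundaries_lift (n : nat) : Prop := forall K c a,
  above K c -> c = unit_diff a -> exists2 a', above (K - n%:Z) a' & c = unit_diff a'.

Let spread : nat := (\sum_x \sum_y `|Q x - Q y|)%N.

Let spreadP x y : (`|Q x - Q y| <= spread)%N.
Proof.
rewrite /spread (bigD1 x) //= (bigD1 y) //= -addnA; exact: leq_addr.
Qed.

(** If [c] is nonzero, some degree is at least [K], and no degree lies more than [spread] below it.
    This provides an exponent that kills all torsion. *)
Lemma boundaries_lift_large : boundaries_lift spread.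
Proof.
move=> K c a cK E; have [c0|] := eqVneq c 0.
  by exists 0; [move=> x _; rewrite ffunE | rewrite unit_diff0].
move=> c0; have [x xc] : exists x, c x != 0.
  apply/existsP; apply: contraNT c0; rewrite negb_exists => /forallP H.
  by apply/eqP/ffunP => x; rewrite ffunE; apply/eqP; have := H x; rewrite negbK.
exists a => // y yK.
have xK : K <= Q x by rewrite leNgt; apply/negP => /cK xc0; rewrite xc0 eqxx in xc.
by exfalso; have := spreadP x y; lia.
Qed.

(** The homogenization of a boundary at H = 1 is a torsion cycle, as [a] can be homogenized [spread]
    degrees lower. Slicing a primitive of its multiple by H^n gives [a']. *)
Lemma torsion_killed_lift n : torsion_killed n -> boundaries_lift n.
Proof.
move=> tk K c a cK ca.
(* The zero chain lies above every [K], so it does not bound [K] by a degree. *)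
have [c0|] := eqVneq c 0.
  by exists 0; [move=> x _; rewrite ffunE | rewrite unit_diff0].
move=> c0; have [x xc] : exists x, c x != 0.
  apply/existsP; apply: contraNT c0; rewrite negb_exists => /forallP H.
  by apply/eqP/ffunP => x; rewrite ffunE; apply/eqP; have := H x; rewrite negbK.
have xK : K <= Q x by rewrite leNgt; apply/negP => /cK xc0; rewrite xc0 eqxx in xc.
have aK : above (K - spread%:Z) a by move=> y yK; exfalso; have := spreadP x y; lia.
have [||C EC] := tk (lift K c).
- rewrite poly_diff_lift // ca unit_diff_square.
  by apply/ffunP => y; rewrite !ffunE scale0r.
- exists spread; exists (lift (K - spread%:Z) a).
  by rewrite poly_diff_lift // -ca scaled_lift.
exists (slice (K - n%:Z) C); first exact: slice_above.
by rewrite -slice_diff -EC slice_scaled subrK slice_lift.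
Qed.

(** Each homogeneous part of H^n b is a boundary at H = 1 lying [n] steps higher than needed; the
    primitives of all parts are assembled into one polynomial chain. *)
Lemma lift_torsion_killed n : boundaries_lift n -> torsion_killed n.
Proof.
move=> bl b _ [m [a E]].
pose good K (a' : {ffun T -> F^o}) := [forall x, (Q x < K) ==> (a' x == 0)]
  && (unit_diff a' == slice K (scaled n b)).
have ex K : exists a', good K a'.
  have [||a' a'K E'] := bl (K + n%:Z) (slice K (scaled n b)) (slice (K + n%:Z - m%:Z) a).
  - by rewrite slice_scaled; apply: slice_above.
  - by rewrite -slice_diff -E !slice_scaled subrK.
  exists a'; rewrite /good E' eqxx andbT; apply/forallP => x; apply/implyP => xK.
  by apply/eqP/a'K; rewrite addrK.
(* Choosing 0 for a zero slice leaves finitely many degrees, so that [C] has polynomial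
   coefficients. *)
pose A K := if slice K (scaled n b) == 0 then 0 else xchoose (ex K).
have AP K : above K (A K) /\ unit_diff (A K) = slice K (scaled n b).
  rewrite /A; case: eqP => [->|_]; first by split; [move=> x _; rewrite ffunE | exact: unit_diff0].
  have /andP[/forallP H /eqP ->] := xchooseP (ex K); split=> // x xK.
  by have := H x; rewrite xK => /eqP.
(* If Q x - K >= N, then Q y - K exceeds every exponent of the chain for all y, so its slice in
   degree K is zero. *)
pose N := (spread + \sum_y size (scaled n b y))%N.
pose C : {ffun T -> {poly F}} := [ffun x => \poly_(e < N) (A (Q x - e%:Z) x : F)].
exists C; apply: slice_inj => K; have [AK <-] := AP K; rewrite slice_diff; congr unit_diff.
apply/ffunP => x; rewrite [RHS]ffunE; case: (leP K (Q x)) => xK; last exact: AK.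
rewrite ffunE coef_poly (_ : Q x - `|Q x - K|%:Z = K); last lia.
case: ltnP => // leN; rewrite /A ifT ?ffunE //; apply/eqP/ffunP => y.
rewrite [LHS]ffunE [RHS]ffunE.
case: ifP => yK //; have/leq_sizeP -> // : (size (scaled n b y) <= `|Q y - K|)%N.
have : (size (scaled n b y) <= \sum_z size (scaled n b z))%N.
  by rewrite (bigD1 y) //=; apply: leq_addr.
by have := spreadP x y; move: leN; rewrite /N; lia.
Qed.

End Level.
End GradedMatrix.

(** * Pages of the spectral sequence and primitives of boundaries *)

Section Pages.
Import Order.TTheory Num.Theory.

Variables (F : fieldType) (T : finType) (M : T -> T -> {poly F}) (q g : T -> int).
Variables (d : 'End({ffun T -> F^o})) (Fil : int -> int -> {vspace {ffun T -> F^o}}).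
Hypothesis M_square : forall x z, \sum_y M x y * M y z = 0.
Hypothesis M_g : forall x y, g y != g x + 1 -> M x y = 0.
Hypothesis M_q : forall x y e,
  (M x y)`_e = if q y - q x == 2 * e%:Z then (M x y).[1] else 0.
Hypothesis dE : forall c, d c = unit_diff M c.
Hypothesis FilP : forall i j (c : {ffun T -> F^o}),
  c \in Fil i j <-> (forall x, ~~ ((g x == i) && (j <= q x)) -> c x = 0).
Implicit Types c : {ffun T -> F^o}.

(* [M] only links degrees of the same parity, so rounding treats both parities at once;
   [r] selects which of them the filtration index [2 * K + r] bounds sharply. *)
Definition level (r : int) (x : T) : int := ((q x - r) %/ 2)%Z.

Lemma M_odd x y : (forall k, q y - q x != 2 * k) -> M x y = 0.
Proof. by move=> H; apply/polyP => e; rewrite M_q (negPf (H _)) coef0. Qed.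

Lemma level_homogeneous r x y e :
  (M x y)`_e = if level r y - level r x == e%:Z then (M x y).[1] else 0.
Proof.
pose k := ((q y - q x) %/ 2)%Z.
have [E|N] := eqVneq (q y - q x) (2 * k).
  have -> : level r y - level r x = k by rewrite /level; lia.
  by rewrite M_q E; congr (if _ then _ else _); apply/eqP/eqP; lia.
rewrite M_odd ?coef0 ?horner0 ?if_same // => k'.
by apply: contraNneq N => E; apply/eqP; rewrite /k; lia.
Qed.

Lemma level_le r K x : (K <= level r x) = (2 * K + r <= q x).
Proof. by rewrite /level; apply/idP/idP; lia. Qed.

Definition proj i c : {ffun T -> F^o} := [ffun x => if g x == i then c x else 0].

Lemma unit_diff_proj i c : unit_diff M (proj i c) = proj (i + 1) (unit_diff M c).
Proof.
apply/ffunP => y; rewrite !ffunE; case: eqP => [gy|/eqP gy].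
  apply: eq_bigr => x _; rewrite ffunE; case: eqP => [//|/eqP gx].
  by rewrite M_g ?horner0 ?mulr0 // gy (inj_eq (addIr 1)) eq_sym.
apply: big1 => x _; rewrite ffunE; case: eqP => [gx|_]; last by rewrite mul0r.
by rewrite M_g ?horner0 ?mulr0 // gx.
Qed.

Lemma mem_Fil i r K c :
  c \in Fil i (2 * K + r) <-> above (level r) K c /\ proj i c = c.
Proof.
rewrite FilP; split=> [H|[H1 H2] x].
  split=> [x xK|]; first by rewrite H // -level_le negb_and -ltNge xK orbT.
  by apply/ffunP => x; rewrite ffunE; case: ifP => // gx; rewrite H ?gx.
rewrite negb_and -level_le -ltNge => /orP[gx|/H1 //].
by rewrite -H2 ffunE (negPf gx).
Qed.

Lemma proj_Fil i r K c : above (level r) K c -> proj i c \in Fil i (2 * K + r).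
Proof.
move=> cK; apply/mem_Fil; split=> [x xK|]; first by rewrite ffunE cK ?if_same.
by apply/ffunP => x; rewrite !ffunE; case: (g x == i).
Qed.

Lemma parity_split (j : int) : exists K r : int, j = 2 * K + r.
Proof. by exists (j %/ 2)%Z, (j %% 2)%Z; lia. Qed.

Let add2 (K r : int) (n : nat) : 2 * K + r + 2 * n%:Z = 2 * (K + n%:Z) + r.
Proof. by lia. Qed.
Let sub2 (K r : int) (n : nat) : 2 * K + r - 2 * n%:Z = 2 * (K - n%:Z) + r.
Proof. by lia. Qed.
Let succ2 (K r : int) : 2 * K + r + 2 = 2 * (K + 1) + r.
Proof. by lia. Qed.

(** The denominator of page n + 1 consists of boundaries of chains n steps lower, as in
    [boundaries_lift]. For the numerator, the boundary of an almost cycle lies n + 1 steps up, so it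
    has a primitive one step up; subtracting that leaves a cycle. *)
Lemma torsion_killed_pages n : torsion_killed M n -> page_eq_infinity d Fil n.+1.
Proof.
move=> tk i j; have [K [r ->]] := parity_split j.
have bl : boundaries_lift M (level r) n.
  exact: torsion_killed_lift (level_homogeneous r) _ tk.
split; apply/eqP; rewrite eqEsubv; apply/andP; split; rewrite subv_add addvSr andbT;
  apply/subvP => c.
- rewrite /almost_cycles memv_cap -memv_preim add2 dE => /andP[ci /mem_Fil[dK dp]].
  have [|//|a aK E] := bl (K + n.+1%:Z) (unit_diff M c) c; first exact: dK.
  have aK1 : above (level r) (K + 1) a.
    by rewrite (_ : K + 1 = K + n.+1%:Z - n%:Z) //; lia.
  have pa : proj i a \in Fil i (2 * K + r + 2) by rewrite succ2; apply: proj_Fil.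
  rewrite -[c](subrK (proj i a)) memv_add //.
  rewrite memv_cap memv_ker linearB /= !dE unit_diff_proj -E dp subrr eqxx andbT.
  apply: rpredB => //; apply/mem_Fil; split; last first.
    by case: (proj1 (mem_Fil _ _ _ _) (proj_Fil i aK1)).
  by move=> x xK; rewrite ffunE aK1 ?if_same //; lia.
- rewrite memv_cap memv_ker => /andP[ci /eqP dc].
  rewrite -[c]addr0 memv_add ?mem0v // /almost_cycles memv_cap ci -memv_preim dc mem0v //.
- case/memv_imgP=> a; rewrite /almost_cycles memv_cap -memv_preim => /andP[_].
  rewrite subrK subrK => da ->; rewrite -[d a]addr0 memv_add ?mem0v //.
  by rewrite memv_cap da memv_img ?memvf.
rewrite memv_cap => /andP[ci /memv_imgP[a _ E]].
have [cK pc] := proj1 (mem_Fil _ _ _ _) ci.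
have [||a' a'K E'] := bl K c a; rewrite // -?dE //.
have pa := proj_Fil (i - 1) a'K.
have Ec : c = d (proj (i - 1) a') by rewrite dE unit_diff_proj subrK -E' pc.
rewrite -[c]addr0 memv_add ?mem0v // Ec memv_img // /almost_cycles /= sub2.
by rewrite memv_cap pa -memv_preim -Ec subrK -sub2 subrK.
Qed.

(** Equal denominators give a primitive modulo the next filtration step. Iterating exhausts the
    finite filtration, and the primitives only move up. This is done in each homological degree
    separately, like the filtration. *)
Lemma pages_torsion_killed n : page_eq_infinity d Fil n.+1 -> torsion_killed M n.
Proof.
move=> pg; apply: (lift_torsion_killed (Q := level 0) (level_homogeneous 0)) => K c a cK ca.
have step i (K' : int) c' a' : c' \in Fil i (2 * K' + 0) -> c' = d a' ->
    exists2 b, above (level 0) (K' - n%:Z) b & c' - d b \in Fil i (2 * (K' + 1) + 0).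
  move=> ci ca'; have [_ E] := pg i (2 * K' + 0).
  have : c' \in page_den_inf d Fil i (2 * K' + 0).
    by rewrite -[c']addr0 memv_add ?mem0v // memv_cap ci ca' memv_img ?memvf.
  rewrite -E => /memv_addP[u /memv_imgP[b bA ->] [w wF ->]].
  exists b; last by rewrite addrAC subrr add0r -succ2.
  by move: bA; rewrite /almost_cycles memv_cap /= sub2 => /andP[/mem_Fil[]].
have top : exists N : nat, forall x, level 0 x < N%:Z.
  exists (\sum_x `|level 0 x|).+1%N => x; rewrite (bigD1 x) //=.
  by move: (\sum_(_ | _) _)%N => m; lia.
have [N topN] := top.
have descend i (t : nat) : forall (K' : int) c' a',
    N%:Z <= K' + t%:Z -> c' \in Fil i (2 * K' + 0) -> c' = d a' ->
    exists2 b, above (level 0) (K' - n%:Z) b & c' = d b.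
  elim: t => [|t IH] K' c' a' NK ci ca'.
    exists 0; first by move=> x _; rewrite ffunE.
    rewrite linear0; apply/ffunP => x; rewrite ffunE.
    have [cK' _] := proj1 (mem_Fil _ _ _ _) ci; apply: cK'.
    by apply: lt_le_trans (topN x) _; rewrite addr0 in NK.
  have [b bK bF] := step i K' c' a' ci ca'.
  have [||b' b'K E'] := IH (K' + 1) (c' - d b) (a' - b) _ bF.
  - by lia.
  - by rewrite ca' -linearB.
  exists (b' + b); last by rewrite linearD /= -E' subrK.
  by move=> x xK; rewrite ffunE bK // b'K ?addr0 //; lia.
pose I := undup [seq g x | x <- enum T].
have cI : c = \sum_(i <- I) proj i c.
  apply/ffunP => x; rewrite sum_ffunE (bigD1_seq (g x)) ?undup_uniq //=; last first.
    by rewrite mem_undup map_f // mem_enum.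
  rewrite ffunE eqxx big1 ?addr0 // => i; rewrite ffunE eq_sym.
  by move/negPf->.
suff [b bK E] : exists2 b, above (level 0) (K - n%:Z) b & \sum_(i <- I) proj i c = d b.
  by exists b => //; rewrite -dE -E.
elim: I {cI} => [|i I [b bK E]].
  by exists 0; [move=> x _; rewrite ffunE | rewrite big_nil linear0].
have [|||b' b'K E'] := @descend i `|(N%:Z - K)%R|%N K (proj i c) (proj (i - 1) a).
- by lia.
- exact: proj_Fil.
- by rewrite dE unit_diff_proj subrK -ca.
exists (b' + b); last by rewrite big_cons E E' linearD.
by move=> x xK; rewrite ffunE bK // b'K ?addr0.
Qed.

Lemma page_eq_infinityE n : page_eq_infinity d Fil n.+1 <-> torsion_killed M n.
Proof. by split; [apply: pages_torsion_killed | apply: torsion_killed_pages]. Qed.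
End Pages.

(** * The reduced Bar-Natan complex as a graded matrix *)

Section Reduced.
Variables (F : fieldType) (D : diagram) (p : 'I_(narcs D)).
Hypothesis toggle : forall k (v w : vertex D), is_edge k v w ->
  same_circle w (arc k 0) (arc k 2) = ~~ same_circle v (arc k 0) (arc k 2).

Definition reduced_coef (x y : rstate p) : {poly F} := dcoef (BarNatan F) (val x) (val y).

Lemma sum_reduced (R : nmodType) (f : state D -> R) : (forall x, ~~ lab x p -> f x = 0) ->
  \sum_x f x = \sum_(x : rstate p) f (val x).
Proof.
move=> f0; rewrite (bigID (fun x => lab x p)) /= [X in _ + X]big1 // addr0.
exact: (big_sub [pred x | lab x p]).
Qed.

(** The entry is read off from d^2 applied to a basis vector; intermediate states outside the
    reduced complex drop out by [reduced_stable]. *)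
Lemma reduced_coef_square x z : \sum_y reduced_coef x y * reduced_coef y z = 0.
Proof.
rewrite -(@sum_reduced _
    (fun y => dcoef (BarNatan F) (val x) y * dcoef (BarNatan F) y (val z)));
  last by move=> y yp; rewrite (reduced_stable _ (valP x) yp) mul0r.
have /ffunP/(_ (val z)) := BarNatan_square toggle [ffun y => (y == val x)%:R : {poly F}].
rewrite !ffunE => E; rewrite -[RHS]E; apply: eq_bigr => y _; congr (_ * _).
rewrite ffunE (bigD1 (val x)) //= ffunE eqxx mul1r big1 ?addr0 // => y' /negPf yx.
by rewrite ffunE yx mul0r.
Qed.

Definition restrict (b : chain {poly F} D) : {ffun rstate p -> {poly F}} :=
  [ffun x => b (val x)].

Lemma restrict_differential b : reduced p b ->
  restrict (differential (BarNatan F) b) = poly_diff reduced_coef (restrict b).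
Proof.
move=> rb; apply/ffunP => y; rewrite !ffunE sum_reduced => [|x xp]; last by rewrite rb ?mul0r.
by apply: eq_bigr => x _; rewrite ffunE.
Qed.

Lemma reduced_differential b : reduced p b -> reduced p (differential (BarNatan F) b).
Proof.
move=> rb y yp; rewrite ffunE big1 // => x _.
by have [xp|xp] := boolP (lab x p); [rewrite (reduced_stable _ xp yp) mulr0 | rewrite rb ?mul0r].
Qed.

Lemma restrict_inj b b' : reduced p b -> reduced p b' -> restrict b = restrict b' -> b = b'.
Proof.
move=> rb rb' /ffunP E; apply/ffunP => x; have [xp|xp] := boolP (lab x p).
  by have := E (Sub x xp); rewrite !ffunE SubK.
by rewrite rb ?rb'.
Qed.

Lemma restrict_surj (c : {ffun rstate p -> {poly F}}) : exists2 b, reduced p b & restrict b = c.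
Proof.
exists [ffun x => if insub x is Some y then c y else 0].
  by move=> x xp; rewrite ffunE insubN.
by apply/ffunP => x; rewrite !ffunE valK.
Qed.

Lemma restrict_boundary n b : reduced p b ->
  (exists2 a, reduced p a & [ffun x => 'X ^+ n * b x] = differential (BarNatan F) a) <->
  (exists a, scaled n (restrict b) = poly_diff reduced_coef a).
Proof.
move=> rb; have sE : scaled n (restrict b) = restrict [ffun x => 'X ^+ n * b x].
  by apply/ffunP => x; rewrite !ffunE.
have rnb : reduced p [ffun x => 'X ^+ n * b x] by move=> x xp; rewrite ffunE rb ?mulr0.
split=> [[a ra E]|[c E]]; first by exists (restrict a); rewrite sE E restrict_differential.
have [a ra ac] := restrict_surj c; exists a => //.
apply: restrict_inj => //; first exact: reduced_differential.
by rewrite -sE E restrict_differential // ac.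
Qed.

Lemma restrict_cycle b : reduced p b ->
  differential (BarNatan F) b = 0 <-> poly_diff reduced_coef (restrict b) = 0.
Proof.
move=> rb; rewrite -restrict_differential //; split=> [->|E].
  by apply/ffunP => x; rewrite !ffunE.
apply: restrict_inj; [exact: reduced_differential | by move=> x _; rewrite ffunE|].
by rewrite E; apply/ffunP => x; rewrite !ffunE.
Qed.

Lemma H_kills_torsionE n : H_kills_torsion F p n <-> torsion_killed reduced_coef n.
Proof.
split=> T.
  move=> c dc [m mc]; have [b rb E] := restrict_surj c; rewrite -{}E in dc mc *.
  apply/(restrict_boundary n rb); apply: T => //; first exact/(restrict_cycle rb).
  by exists m; apply/(restrict_boundary m rb).
move=> b rb db [m mb]; apply/(restrict_boundary n rb).
apply: T; first exact/(restrict_cycle rb).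
by exists m; apply/(restrict_boundary m rb).
Qed.

Lemma mem_BLT_filtration i j (c : BLT_chain F p) : c \in BLT_filtration F p i j <->
  (forall x : rstate p, ~~ ((hdeg (val x) == i) && (j <= qdeg (val x))) -> c x = 0).
Proof.
set P := fun x : rstate p => (hdeg (val x) == i) && (j <= qdeg (val x)).
split=> [cF x Px|c0].
  pose s := in_tuple [seq BLT_basis F x | x <- enum {: rstate p} & P x].
  have -> : c = \sum_k coord s k c *: s`_k by apply: coord_span.
  rewrite sum_ffunE big1 // => k _; rewrite ffunE.
  have /mapP[y] : s`_k \in [seq BLT_basis F x | x <- enum {: rstate p} & P x].
    by apply: mem_nth; apply: ltn_ord.
  rewrite mem_filter => /andP[Py _] ->; rewrite ffunE; case: eqP => [xy|_].
    by case/negP: Px; rewrite xy; apply: Py.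
  exact: scaler0.
have -> : c = \sum_x c x *: BLT_basis F x.
  apply/ffunP => y; rewrite sum_ffunE (bigD1 y) //= big1 ?addr0 => [|x xy].
    by rewrite !ffunE eqxx [RHS]mulr1.
  by rewrite !ffunE eq_sym (negPf xy) [LHS]mulr0.
apply: memv_suml => x _; have [Px|/c0 ->] := boolP (P x); last by rewrite scale0r mem0v.
by apply/memvZ/memv_span/map_f; rewrite mem_filter -/(P x) Px mem_enum.
Qed.
End Reduced.

Lemma least_exists (P : nat -> Prop) n : P n -> exists m, is_least P m.
Proof.
elim/ltn_ind: n => n IH Pn; have [[m mn Pm]|N] := classic (exists2 m, (m < n)%N & P m).
  exact: IH Pm.
by exists n; split=> // m Pm; rewrite leqNgt; apply/negP => mn; apply: N; exists m.
Qed.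

Theorem theorem1p1 (F : fieldType) (D : diagram) (p : 'I_(narcs D)) :
  2%N \notin [pchar F] -> knot_diagram D ->
  exists n k : nat, [/\ is_X_torsion_order F p n, is_reduced_pages F p k
    & n%:Z = k%:Z - 1].
Proof.
move=> char2 knotD.
have toggle k (v w : vertex D) (ed : is_edge k v w) := edge_toggles_circles knotD k ed.
pose M := @reduced_coef F D p.
have Mq x y e : (M x y)`_e =
    if qdeg (val y) - qdeg (val x) == 2 * e%:Z then (M x y).[1] else 0.
  exact: dcoef_homogeneous toggle _ _ _.
have Mg x y : hdeg (val y) != hdeg (val x) + 1 -> M x y = 0 by apply: dcoef_hdeg.
have M2 : forall x z, \sum_y M x y * M y z = 0 by apply: reduced_coef_square.
have torsE n : Xpow_kills_torsion F p n <-> torsion_killed M n.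
  exact: iff_trans (Xpow_kills_torsionE p char2 toggle n) (H_kills_torsionE F p n).
have pagesE n : page_eq_infinity (linfun (@BLT_differential F D p)) (BLT_filtration F p) n.+1
    <-> torsion_killed M n.
  apply: (page_eq_infinityE M2 Mg Mq) => [c|i j c]; last exact: mem_BLT_filtration.
  by rewrite lfunE.
have lvl := level_homogeneous Mq 0.
(* The spread of the degrees is an exponent that works, so there is a least one. *)
have [n [Pn least_n]] : exists n, is_least (Xpow_kills_torsion F p) n.
  exact: least_exists (proj2 (torsE _) (lift_torsion_killed lvl (@boundaries_lift_large _ _ M _))).
exists n, n.+1; split; [by split | | by rewrite -addn1 PoszD addrK].
split; first by split=> //; apply/pagesE/torsE.
by case=> [[]//|m [_ /pagesE/torsE/least_n]].
Qed.
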